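(* Let $D=8$ and consider $T^*\mathbb{R}^8$ with coordinates $(x_1,\dots,x_8,p_1,\dots,p_8)$ and the Hamiltonian $H$ given by $$2H=\left(p_1-\tfrac12x_2p_3-\tfrac12(x_1^2+x_2^2)p_5-\tfrac14x_1x_2^2p_7-\tfrac16x_2^3p_8\right)^2+\left(p_2+\tfrac12x_1p_3+\tfrac12(x_1^2+x_2^2)p_4+\tfrac16x_1^3p_6+\tfrac14x_1^2x_2p_7\right)^2,$$ which is the Hamiltonian of the left-invariant sub-Riemannian structure on the $(2,3,5,8)$-distribution. Then for no degree $d\le 5$ does $H$ admit a final integral of degree $d$. That is, for each integer $1\le d\le 5$ there is no function of the form $$F=\sum_{|\tau|=d}a_\tau(x_1,x_2)\,p^\tau$$ with smooth coefficients $a_\tau$ such that $\{H,F\}=0$ and such that $H,p_3,p_4,p_5,p_6,p_7,p_8,F$ are functionally independent almost everywhere.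
   Context: $\{\cdot,\cdot\}$ is the Poisson bracket of the canonical symplectic structure on $T^*\mathbb{R}^8$. For a multi-index $\tau=(\tau_1,\dots,\tau_8)$ of non-negative integers, $p^\tau=\prod_{i=1}^8p_i^{\tau_i}$ and $|\tau|=\sum_i\tau_i$. The $(2,3,5,8)$-distribution is the left-invariant rank 2 distribution $\Delta=\langle e_1,e_2\rangle$ on the simply connected 8-dimensional Carnot group $G\cong\mathbb{R}^8$ whose Lie algebra $\langle e_1,\dots,e_8\rangle$ (the free truncated graded nilpotent Lie algebra) has the nontrivial brackets $$[e_1,e_2]=e_3,\ [e_1,e_3]=e_4,\ [e_2,e_3]=e_5,\ [e_1,e_4]=e_6,\ [e_1,e_5]=[e_2,e_4]=e_7,\ [e_2,e_5]=e_8.$$ The left-invariant sub-Riemannian metric on $\Delta$ is the one with orthonormal frame $e_1,e_2$. Its Hamiltonian is $H=\frac12(\omega_1^2+\omega_2^2)$, where $\omega_i$ is the fiberwise linear function on $T^*G$ defined by the left-invariant vector field $e_i$. In suitable global coordinates $x_1,\dots,x_8$ on $G$ it takes the form displayed in the claim. The Hamiltonian does not depend on $x_3,\dots,x_8$, so $p_3,\dots,p_8$ are integrals. Together with $H$ they form an involutive family of 7 functionally independent integrals. A ''final integral of degree $d$'' is one more integral completing this family to a Liouville integrable one: a function $F$ on $T^*G$, smooth in the base variables and homogeneous polynomial of degree $d$ in the momenta, which Poisson-commutes with $H,p_3,\dots,p_8$ and is such that $H,p_3,\dots,p_8,F$ are functionally independent almost everywhere. Commuting with $p_3,\dots,p_8$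 means precisely that the coefficients of $F$ depend on $x_1,x_2$ only. *)

(* Defs.v *)
From HB Require Import structures.
From mathcomp Require Import all_boot all_order all_algebra.
From mathcomp Require Import all_classical all_reals all_analysis.

Set Implicit Arguments.
Unset Strict Implicit.
Unset Printing Implicit Defensive.

Import Order.TTheory GRing.Theory Num.Theory.
Import numFieldNormedType.Exports.

Local Open Scope classical_set_scope.
Local Open Scope ring_scope.

(* [Ck k.+1 f] asks for Frechet differentiability and for every directional
   derivative to be [Ck k]; on a finite-dimensional [V] this is the usual class
   of k.+1 times continuously differentiable functions. *)
Fixpoint Ck (R : realType) (V : normedModType R) (k : nat) (f : V -> R) : Prop :=
  if k is k'.+1 then
    (forall x, differentiable f x) /\ (forall v, Ck k' (fun x => 'D_v f x))
  else continuous f.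

Definition smooth (R : realType) (V : normedModType R) (f : V -> R) : Prop :=
  forall k, Ck k f.

Section EuclideanSpace.
Variables (R : realType) (n : nat).
Implicit Types (f : 'rV[R]_n -> R) (z a b : 'rV[R]_n).

Definition partial (i : 'I_n) f z : R := 'D_(delta_mx 0 i) f z.

Definition gradient f z : 'rV[R]_n := \row_i partial i f z.

Definition independent_at (fs : seq ('rV[R]_n -> R)) z : Prop :=
  row_free (\matrix_(k < size fs) gradient (nth (fun=> 0) fs k) z).

Definition box a b : set 'rV[R]_n :=
  [set z | forall i, a 0 i <= z 0 i <= b 0 i].

Definition box_volume a b : R := \prod_i (b 0 i - a 0 i).

(* The library has no Lebesgue measure on R^n: a set is null when countably many
   boxes of arbitrarily small total volume cover it. *)
Definition lebesgue_null (A : set 'rV[R]_n) : Prop :=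
  forall e : R, 0 < e ->
  exists a b : nat -> 'rV[R]_n,
    [/\ forall k i, a k 0 i <= b k 0 i,
        A `<=` \bigcup_k box (a k) (b k) &
        (\sum_(0 <= k <oo) (box_volume (a k) (b k))%:E <= e%:E)%E].

Definition almost_everywhere (P : 'rV[R]_n -> Prop) : Prop :=
  lebesgue_null [set z | ~ P z].

End EuclideanSpace.

(* A point of the cotangent bundle of R^n is the row vector
   (x_1, ..., x_n, p_1, ..., p_n). *)
Notation cotangent R n := 'rV[R]_(n + n).

Definition poisson (R : realType) (n : nat) (f g : cotangent R n -> R)
    (z : cotangent R n) : R :=
  \sum_(i < n) (partial (lshift n i) f z * partial (rshift n i) g z
              - partial (rshift n i) f z * partial (lshift n i) g z).

Definition position (R : realType) (n : nat) (i : 'I_n) (z : cotangent R n) : R :=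
  z 0 (lshift n i).

Definition momentum (R : realType) (n : nat) (i : 'I_n) (z : cotangent R n) : R :=
  z 0 (rshift n i).

(* For a numeral k between 1 and 8, 'x_k and 'p_k are the coordinates x_k and
   p_k on the cotangent bundle of R^8; the ordinal index is shifted by one. *)
Notation ord8 k := (@Ordinal 8 k.-1 isT).
Notation "''x_' k" := (position (ord8 k%N))
  (at level 0, k at level 0, format "''x_' k").
Notation "''p_' k" := (momentum (ord8 k%N))
  (at level 0, k at level 0, format "''p_' k").

Definition omega1 (R : realType) (z : cotangent R 8) : R :=
  'p_1 z - 2^-1 * 'x_2 z * 'p_3 z
  - 2^-1 * ('x_1 z ^+ 2 + 'x_2 z ^+ 2) * 'p_5 z
  - 4^-1 * 'x_1 z * 'x_2 z ^+ 2 * 'p_7 z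
  - 6^-1 * 'x_2 z ^+ 3 * 'p_8 z.

Definition omega2 (R : realType) (z : cotangent R 8) : R :=
  'p_2 z + 2^-1 * 'x_1 z * 'p_3 z
  + 2^-1 * ('x_1 z ^+ 2 + 'x_2 z ^+ 2) * 'p_4 z
  + 6^-1 * 'x_1 z ^+ 3 * 'p_6 z
  + 4^-1 * 'x_1 z ^+ 2 * 'x_2 z * 'p_7 z.

Definition H2358 (R : realType) (z : cotangent R 8) : R :=
  2^-1 * (omega1 z ^+ 2 + omega2 z ^+ 2).

(* Since |tau| = d forces tau_i <= d, the multi-indices of length d are the
   [tau] in this finite type with [mdegree tau = d]. *)
Definition multi_index (d : nat) := {ffun 'I_8 -> 'I_d.+1}.

Definition mdegree (d : nat) (tau : multi_index d) : nat := (\sum_i tau i)%N.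

Definition momentum_form (R : realType) (d : nat)
    (a : multi_index d -> R * R -> R) (z : cotangent R 8) : R :=
  \sum_(tau : multi_index d | mdegree tau == d)
    a tau ('x_1 z, 'x_2 z) * \prod_(i < 8) momentum i z ^+ tau i.

Definition final_integral (R : realType) (d : nat)
    (F : cotangent R 8 -> R) : Prop :=
  [/\ exists a : multi_index d -> R * R -> R,
        (forall tau, mdegree tau = d -> smooth (a tau)) /\
        (forall z, F z = momentum_form a z),
      forall z, poisson (@H2358 R) F z = 0 &
      almost_everywhere (independent_at
        [:: @H2358 R; 'p_3; 'p_4; 'p_5; 'p_6; 'p_7; 'p_8; F])].

(* Main.v *)
(* For fixed momenta p_3, ..., p_8 the flow of H is the motion of a charged
   particle in the plane, x' = v, v' = B(x) J v, in the magnetic field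
   B = p_3 + x_1 p_4 + x_2 p_5 + x_1^2 p_6 / 2 + x_1 x_2 p_7 + x_2^2 p_8 / 2, and F
   is an integral of it that is polynomial in v = (omega_1, omega_2).  If
   p_7 <> 0 and p_7^2 <> p_6 p_8, such an integral is a polynomial in |v|^2, of any
   degree: its differential is then proportional to that of H on the fibres, so
   that H, p_3, ..., p_8, F are dependent on an open set.

   Work with the Taylor coefficients at a point, in the complex coordinates
   z = x_1 + i x_2, w = v_1 + i v_2 and their conjugates.  The top coefficients in v
   form a Killing tensor, so only finitely many coefficients are non-zero, and one
   may consider leading parts for the weights (1, 1, 3, 3) of (z, zb, w, wb): these
   are integrals of the system with B replaced by its quadratic part
   al z^2 + be z zb + ga zb^2.  Among these, the leading part for the weight that
   favours z over zb is an integral for B = al z^2, whose only integrals are the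
   polynomials in w wb and I = w - al z^3 / 3 (up to normalisation).  Powers I^a
   with a > 0 survive the perturbation be z zb to first order, but at second order
   the obstruction is a non-zero multiple of be^2 - 4 al ga. *)
From HB Require Import structures.
Require Import Defs.
From mathcomp Require Import all_boot all_order all_algebra.
From mathcomp Require Import all_classical all_reals all_analysis.
From mathcomp Require Import measurable_realfun complex.
From mathcomp Require Import zify ring lra.

Set Implicit Arguments.
Unset Strict Implicit.
Unset Printing Implicit Defensive.

Import Order.TTheory GRing.Theory Num.Theory.
Import numFieldNormedType.Exports.

Local Open Scope classical_set_scope.
Local Open Scope ring_scope.

(** * A triangular linear recursion *)

Lemma int_ind_ge (P : int -> Prop) (m : int) :
  P m -> (forall k, m <= k -> P k -> P (k + 1)) -> forall k, m <= k -> P k.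
Proof.
move=> Pm PS k mk; have -> : k = m + `|k - m|%N by lia.
elim: `|k - m|%N => [|n IHn]; first by rewrite addr0.
by rewrite -addn1 PoszD addrA; apply: PS => //; lia.
Qed.

Lemma int_ind_neg (P : int -> Prop) :
  (forall k, k < 0 -> P k) -> (forall k, 0 <= k -> P (k - 1) -> P k) ->
  forall k, P k.
Proof.
move=> Pneg PS k; have [/Pneg //|] := ltP k 0.
apply: int_ind_ge => [|{}k k0 Pk]; first by apply: PS => //; exact: Pneg.
by apply: PS; [lia|rewrite addrK].
Qed.

Lemma lincomb3_eq0 (K : pzRingType) (c1 c2 c3 x1 x2 x3 y : K) :
  x1 = 0 -> x2 = 0 -> x3 = 0 -> y = c1 * x1 + c2 * x2 + c3 * x3 -> y = 0.
Proof. by move=> -> -> -> ->; rewrite !mulr0 !addr0. Qed.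

Lemma lincomb4_eq0 (K : pzRingType) (c1 c2 c3 c4 x1 x2 x3 x4 y : K) :
  x1 = 0 -> x2 = 0 -> x3 = 0 -> x4 = 0 ->
  y = c1 * x1 + c2 * x2 + c3 * x3 + c4 * x4 -> y = 0.
Proof. by move=> -> -> -> -> ->; rewrite !mulr0 !addr0. Qed.

(* [d b k l] stands for the coefficient of z^a zb^b w^k wb^l with a = S - b - 3 k - 3 l,
   for a fixed weight S; coefficients with a negative exponent are 0. *)
Section Layers.
Variables (K : numFieldType) (al be ga : K) (S : int) (d : int -> int -> int -> K).
Hypothesis al_neq0 : al != 0.
Hypothesis d_out : forall b k l : int,
  [|| b < 0, k < 0, l < 0 | S - b - 3 * k - 3 * l < 0] -> d b k l = 0.
Hypothesis d_rec : forall b k l : int,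
  (S - b - 3 * k - 3 * l + 3)%:~R * d b (k - 1) l + (b + 1)%:~R * d (b + 1) k (l - 1)
  + (k - l)%:~R * (al * d b k l + be * d (b - 1) k l + ga * d (b - 2) k l) = 0.

(** Below the diagonal the factor [k - l] is non-zero, so along a row (fixed [b] and [l]) the
    recursion gives [d b k l] from [d b (k - 1) l] and the neighbouring rows; zeros propagate
    upwards from the entries with [k < 0]. *)
Lemma row_low (m b l : int) : m <= l ->
  (forall k, k < m -> d (b + 1) k (l - 1) = 0) ->
  (forall k, k < m -> d (b - 1) k l = 0) ->
  (forall k, k < m -> d (b - 2) k l = 0) ->
  forall k, k < m -> d b k l = 0.
Proof.
move=> ml h1 h2 h3 k; case: (ltP k (-1)) => [k0 _|].
  by apply: d_out; lia.
elim/int_ind_ge: k / => [_|k k1 IHk km]; first by apply: d_out; lia.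
have := d_rec b (k + 1) l; rewrite addrK IHk; last by lia.
rewrite h1 // h2 // h3 // !mulr0 !addr0 add0r => /eqP.
by rewrite !mulf_eq0 intr_eq0 (negPf al_neq0) /= => /orP[|/eqP //]; lia.
Qed.

(** Beyond the diagonal [k - l] is non-zero again, but the recursion cannot step across [k = l];
    hence the value at the starting index has to be given. *)
Lemma row_high (m b l : int) : l <= m -> d b m l = 0 ->
  (forall k, m < k -> d (b + 1) k (l - 1) = 0) ->
  (forall k, m < k -> d (b - 1) k l = 0) ->
  (forall k, m < k -> d (b - 2) k l = 0) ->
  forall k, m <= k -> d b k l = 0.
Proof.
move=> lm dm h1 h2 h3; apply: int_ind_ge => // k mk dk.
have := d_rec b (k + 1) l; rewrite addrK dk h1 ?h2 ?h3; try lia.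
rewrite !mulr0 !addr0 add0r => /eqP.
by rewrite !mulf_eq0 intr_eq0 (negPf al_neq0) /= => /orP[|/eqP //]; lia.
Qed.

(* The recursion at the monomials (b-1, l, l+1), (b-1, l+1, l+1) and (b, l+1, l)
   determines d b l l twice; this is the vanishing of a residue. *)
Lemma row_zero (b l : int) : 1 <= b ->
  (forall k, d (b + 1) k (l - 1) = 0) ->
  (forall k, d (b - 1) k l = 0) -> (forall k, d (b - 2) k l = 0) ->
  (forall k, k <= l -> d (b - 2) k (l + 1) = 0) ->
  (forall k, k <= l -> d (b - 3) k (l + 1) = 0) ->
  forall k, d b k l = 0.
Proof.
move=> b1 h1 h2 h3 h4 h5.
have low : forall k, k < l -> d b k l = 0 by apply: row_low.
have low' : forall k, k < l -> d (b - 1) k (l + 1) = 0.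
  apply: row_low; first by lia.
  - by move=> k kl; rewrite subrK addrK; apply: low.
  - by move=> k kl; rewrite (_ : b - 1 - 1 = b - 2) ?h4 //; lia.
  - by move=> k kl; rewrite (_ : b - 1 - 2 = b - 3) ?h5 //; lia.
have e1 := d_rec (b - 1) l (l + 1); have e2 := d_rec (b - 1) (l + 1) (l + 1).
have e3 := d_rec b (l + 1) l.
rewrite !subrK !addrK in e1 e2 e3.
rewrite low' ?h1 ?h2 ?h3 in e1 e3; last by lia.
rewrite (_ : b - 1 - 1 = b - 2) in e1; last by lia.
rewrite (_ : b - 1 - 2 = b - 3) in e1; last by lia.
rewrite h4 // h5 // in e1.
have b0 : b%:~R != 0 :> K by rewrite intr_eq0; lia.
have c0 : d b l l = 0.
  (* The exponents of z in [d b l l] and [d (b - 1) l (l + 1)] differ by 2, so eliminating the other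
     unknowns leaves the factor [2 * b]. *)
  have : 2 * b%:~R * d b l l = 0.
    apply: (lincomb3_eq0 (c1 := - (S - b - 6 * l - 2)%:~R) (c2 := - al) (c3 := b%:~R) e1 e2 e3).
    by rewrite !(rmorphD, rmorphM, rmorphB, rmorphN) /=; ring.
  by move/eqP; rewrite !mulf_eq0 (negPf b0) pnatr_eq0 /= => /eqP.
move=> k; case: (ltP k l) => [/low //|]; apply: row_high => //.
Qed.

Hypothesis disc : be ^+ 2 != 4 * al * ga.
Hypothesis d_diag : forall k, S = 6 * k -> d 0 k k = 0.

(** The layer index [b + l] counts conjugate variables: the [al] part of the recursion preserves it,
    while [be] and [ga] bring in the first and second layers below. Residues remove all of layer [n]
    but a multiple of [(w wb)^n I^a]; this is killed by computing [d 2 n n], in layer [n + 2], in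
    two ways. *)
Lemma layer_eq0 (n : int) : (forall b k l, b + l < n -> d b k l = 0) ->
  forall b k l, b + l = n -> d b k l = 0.
Proof.
move=> dn; case: (ltP n 0) => n0.
  by move=> b k l bl; apply: d_out; lia.
(* Each row rests on the row of the same layer with [l - 1] and [b + 1]; the induction on [l] starts
   at the empty rows [l < 0]. *)
have u0 (b k l : int) : 1 <= b -> b + l = n -> d b k l = 0.
  elim/int_ind_neg: l b k => [l l0 b k _ _|l l0 IHl b k b1 bl]; first by apply: d_out; lia.
  apply: row_zero => // [k'|k'|k'|k' _|k' _]; try by apply: dn; lia.
  by apply: IHl; lia.
have u0low (k : int) : k < n -> d 0 k n = 0.
  apply: (@row_low n) => //; move=> {}k kn.
  - by apply: u0; lia.
  - by apply: d_out; lia.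
  - by apply: d_out; lia.
(* The sources from layer [n] vanish by [u0], except at [b - 2 = 0], where the triangular bound
   [u0low] is needed. *)
have u1 (b k l : int) : 2 <= b -> b + l = n + 1 -> d b k l = 0.
  elim/int_ind_neg: l b k => [l l0 b k _ _|l l0 IHl b k b1 bl]; first by apply: d_out; lia.
  apply: row_zero; first by lia.
  - by move=> k'; apply: IHl; lia.
  - by move=> k'; apply: u0; lia.
  - by move=> k'; apply: dn; lia.
  - move=> k' kl; have [b2|b2] := eqVneq b 2; last by apply: u0; lia.
    by rewrite b2 subrr (_ : l + 1 = n); [apply: u0low; lia|lia].
  - by move=> k' _; apply: dn; lia.
have u1low (k : int) : k < n -> d 1 k n = 0.
  apply: row_low => // {}k kn.
  - by apply: u1; lia.
  - by apply: d_out; lia.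
have u1low0 (k : int) : k < n -> d 0 k (n + 1) = 0.
  apply: row_low; [by lia| | |] => {}k kn.
  - by rewrite addrK; apply: u1low.
  - by apply: d_out; lia.
  - by apply: d_out; lia.
have u2 (b k l : int) : 3 <= b -> b + l = n + 2 -> d b k l = 0.
  elim/int_ind_neg: l b k => [l l0 b k _ _|l l0 IHl b k b1 bl]; first by apply: d_out; lia.
  apply: row_zero; first by lia.
  - by move=> k'; apply: IHl; lia.
  - by move=> k'; apply: u1; lia.
  - by move=> k'; apply: u0; lia.
  - move=> k' kl; have [b2|b2] := eqVneq b 3; last by apply: u1; lia.
    by rewrite b2 (_ : l + 1 = n); [apply: u1low; lia|lia].
  - move=> k' kl; have [b2|b2] := eqVneq b 3; last by apply: u0; lia.
    by rewrite b2 subrr (_ : l + 1 = n); [apply: u0low; lia|lia].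
have u2low (k : int) : k < n -> d 2 k n = 0.
  by apply: row_low => // {}k kn; apply: u2; lia.
have u2low1 (k : int) : k < n -> d 1 k (n + 1) = 0.
  apply: row_low; [by lia| | |] => {}k kn.
  - by rewrite addrK; apply: u2low.
  - exact: u1low0.
  - by apply: d_out; lia.
(* Only the row [b = 0], [l = n] with [k >= n] is left, and [row_high] reduces it to its diagonal
   entry. *)
suff C0 : d 0 n n = 0.
  have u00 (k : int) : d 0 k n = 0.
    case: (ltP k n) => [/u0low //|]; apply: row_high => // {}k kn.
    - by apply: u0; lia.
    - by apply: d_out; lia.
    - by apply: d_out; lia.
  move=> b k l bl; case: (ltrgtP b 0) => [b0|b0|b0]; first by apply: d_out; lia.
    by apply: u0 => //; lia.
  by rewrite b0 (_ : l = n) //; lia.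
(* [e] is the exponent of z that accompanies [w^n wb^n]; each further factor w lowers it by 3. *)
pose e := S - 6 * n.
have recC (k : int) : 1 <= k ->
    (e - 3 * (k - 1))%:~R * d 0 (n + k - 1) n + k%:~R * al * d 0 (n + k) n = 0.
  move=> k1; have := d_rec 0 (n + k) n.
  rewrite (u0 (0 + 1)) ?(@d_out (0 - 1)) ?(@d_out (0 - 2)); try lia.
  rewrite !mulr0 !addr0 mulrA => <-; congr (_%:~R * _ + _%:~R * _ * _); rewrite /e; lia.
have [e0|] := ltP e 0; first by apply: d_out; rewrite /e in e0; lia.
rewrite le_eqVlt => /orP[/eqP e0|e0]; first by apply: d_diag; rewrite /e in e0; lia.
have [a [a0 [e3a e3a2]]] : exists a : int, 0 <= a /\ 3 * a <= e /\ e <= 3 * a + 2.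
  by exists (e %/ 3)%Z; lia.
(* If 3 does not divide [e], the exponents of z along the row turn negative without meeting 0, so
   zeros propagate back to the diagonal. If [e = 3 * a], the row is that of [I^a] and second order
   is needed. *)
have [ea3|ea3] := eqVneq e (3 * a); last first.
  have C0 : forall m : int, 0 <= m -> m <= a + 1 -> d 0 (n + (a + 1 - m)) n = 0.
    apply: int_ind_ge => [_|m m0 IHm ma].
      by apply: d_out; rewrite /e in e3a2; lia.
    have := recC (a + 1 - m); rewrite IHm; try lia.
    rewrite mulr0 addr0 => h; have /eqP : _ = 0 := h ltac:(lia).
    rewrite mulf_eq0 intr_eq0 => /orP[|/eqP <-]; first by lia.
    by congr (d _ _ _); lia.
  by rewrite -(C0 (a + 1)); [congr (d _ _ _); lia|lia|lia].
have {}a0 : 1 <= a by lia.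
have eS : S = 3 * a + 6 * n by rewrite -ea3 /e; lia.
(* [C], [X] and [Y] are the parts of order 0, 1 and 2 in zb, indexed so that the exponents of z are
   [3 * m], [3 * m - 1] and [3 * m - 2]. *)
pose C m := d 0 (n + (a - m)) n; pose X m := d 1 (n + (a - m)) n.
pose Y m := d 2 (n + (a - m)) n.
have eC (m : int) : m < a -> (3 * m%:~R + 3) * C (m + 1) + (a - m)%:~R * al * C m = 0.
  move=> ma; rewrite /C -(recC (a - m)); last by lia.
  congr (_ * d _ _ _ + _); last by lia.
  by rewrite -[3]/(3%:~R) -intrM -intrD; congr (_%:~R); rewrite /e eS; lia.
have eX (m : int) : m < a ->
    (3 * m%:~R + 2) * X (m + 1) + (a - m)%:~R * (al * X m + be * C m) = 0.
  move=> ma; have := d_rec 1 (n + (a - m)) n.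
  rewrite (u1 (1 + 1)) ?(@d_out (1 - 2)); try lia.
  rewrite !mulr0 !addr0 subrr => <-; congr (_ * d _ _ _ + _%:~R * _).
  - by rewrite -[3]/(3%:~R) -[2]/(2%:~R) -intrM -intrD; congr (_%:~R); rewrite eS; lia.
  - by lia.
  - by lia.
have eY (m : int) : m < a ->
    (3 * m%:~R + 1) * Y (m + 1) + (a - m)%:~R * (al * Y m + be * X m + ga * C m) = 0.
  move=> ma; have := d_rec 2 (n + (a - m)) n.
  rewrite (u2 (2 + 1)); try lia.
  rewrite !mulr0 !addr0 subrr => <-; congr (_ * d _ _ _ + _%:~R * _).
  - by rewrite -[3]/(3%:~R) -[1]/(1%:~R) -intrM -intrD; congr (_%:~R); rewrite eS; lia.
  - by lia.
  - by lia.
(* [fX] and [fY] solve for the first and second order corrections in terms of [C]; they start from 0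
   since [X 0] and [Y 0] have a negative exponent of z. *)
have fX : forall m : int, 0 <= m -> m <= a -> 2 * al * X m - 3 * be * m%:~R * C m = 0.
  apply: int_ind_ge => [_|m m0 IHm ma].
    by rewrite mulr0 mul0r subr0 /X d_out ?mulr0 //; lia.
  have {}IHm := IHm ltac:(lia).
  have {}eC := eC m ltac:(lia); have {}eX := eX m ltac:(lia).
  have : (3 * m%:~R + 2) * (2 * al * X (m + 1) - 3 * be * (m + 1)%:~R * C (m + 1)) = 0.
    apply: (lincomb3_eq0 (c1 := 2 * al) (c2 := - (be * (3 * m%:~R + 2)))
      (c3 := - (a - m)%:~R * al) eX eC IHm).
    by rewrite !(intrD, rmorphB) /=; ring.
  move/eqP; rewrite mulf_eq0 -[3]/(3%:~R) -[2]/(2%:~R) -intrM -intrD intr_eq0.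
  by move=> /orP[|/eqP //]; lia.
have fY : forall m : int, 0 <= m -> m <= a -> 8 * al ^+ 2 * Y m -
    (9 * be ^+ 2 * m%:~R * (m%:~R - 1) + 24 * ga * al * m%:~R) * C m = 0.
  apply: int_ind_ge => [_|m m0 IHm ma].
    by rewrite !mulr0 mul0r addr0 mul0r subr0 /Y d_out ?mulr0 //; lia.
  have {}IHm := IHm ltac:(lia); have {}fX := fX m ltac:(lia) ltac:(lia).
  have {}eC := eC m ltac:(lia); have {}eY := eY m ltac:(lia).
  have : (3 * m%:~R + 1) * (8 * al ^+ 2 * Y (m + 1) -
    (9 * be ^+ 2 * (m + 1)%:~R * ((m + 1)%:~R - 1) + 24 * ga * al * (m + 1)%:~R)
    * C (m + 1)) = 0.
    apply: (lincomb4_eq0 (c1 := 8 * al ^+ 2)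
      (c2 := - ((3 * be ^+ 2 * m%:~R + 8 * ga * al) * (3 * m%:~R + 1)))
      (c3 := - (a - m)%:~R * al) (c4 := - 4 * al * (a - m)%:~R * be) eY eC IHm fX).
    by rewrite !(intrD, rmorphB) /=; ring.
  move/eqP; rewrite mulf_eq0 -[3]/(3%:~R) -[1]/(1%:~R) -intrM -intrD intr_eq0.
  by move=> /orP[|/eqP //]; lia.
have := fY a ltac:(lia) (lexx _); have := fX a ltac:(lia) (lexx _).
rewrite /X /Y /C subrr addr0 => {fX fY eC eX eY recC X Y C} fX fY.
have e1 := d_rec 0 n (n + 1); have e2 := d_rec 1 n (n + 1).
have e3 := d_rec 1 (n + 1) (n + 1); have e4 := d_rec 2 (n + 1) n.
have e5 := d_rec 1 (n + 1) n; have e6 := d_rec 0 (n + 1) n.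
rewrite !addrK ?(@d_out (0 - 1)) ?(@d_out (0 - 2)) ?(@d_out (1 - 2)) ?subrr
  ?(u1low0 (n - 1)) ?(u2low1 (n - 1)) ?(u1 (1 + 1) (n + 1) (n - 1))
  ?(u2 (2 + 1) (n + 1) (n - 1)) ?(u0 (0 + 1) (n + 1) (n - 1)) in e1 e2 e3 e4 e5 e6;
  try lia.
rewrite ?mulr0 ?mul0r ?addr0 ?add0r eS in e1 e2 e3 e4 e5 e6.
have e2n : 1 + 1 = 2 :> int by [].
rewrite !e2n in e2 e3.
have nrm : (forall x : int, (x + 1 - x)%:~R = 1 :> K)
    * (forall x : int, (x - (x + 1))%:~R = - 1 :> K).
  by split=> x; [rewrite addrAC subrr add0r|rewrite opprD addrA subrr add0r].
rewrite !nrm in e1 e2 e4 e5 e6.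
move: e1 e2 e3 e4 e5 e6 fX fY; rewrite !(rmorphB, intrD, intrM) /= => e1 e2 e3 e4 e5 e6 fX fY.
pose A : K := a%:~R.
(* This is the residue combination of [row_zero] for [b = 2] and [l = n], now with its source terms.
   [T2] expresses these through the diagonal entries, and [fX], [fY] at [m = a] then leave a
   multiple of the discriminant. *)
have T1 : 2 * d 2 n n * 2 + (3 * A - 4) * be * d 0 n (n + 1)
    + 2 * be * d 1 (n + 1) n + 2 * ga * d 0 (n + 1) n = 0.
  by apply: (lincomb3_eq0 (c1 := - (3 * A - 4)) (c2 := - al) (c3 := 2) e2 e3 e4); rewrite /A; ring.
have T2 : 8 * al ^+ 2 * d 2 n n - (6 * A + 4) * al * be * d 1 n n
    - (4 * al * ga - 4 * be ^+ 2) * (3 * A) * d 0 n n = 0.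
  apply: (lincomb4_eq0 (c1 := 2 * al ^+ 2) (c2 := 2 * al * (3 * A - 4) * be)
    (c3 := - 4 * al * be) (c4 := - (4 * al * ga - 4 * be ^+ 2)) T1 e1 e5 e6).
  by rewrite /A; ring.
have : 3 * A * (4 * al * ga - be ^+ 2) * d 0 n n = 0.
  apply: (lincomb3_eq0 (c1 := 1) (c2 := - 1) (c3 := (3 * A + 2) * be) T2 fY fX).
  by rewrite /A; ring.
move/eqP; rewrite !mulf_eq0 pnatr_eq0 intr_eq0 subr_eq0 (eq_sym _ (be ^+ 2)) (negPf disc) orbF.
by move=> /orP[|/eqP //]; lia.
Qed.
End Layers.

(** * Vanishing of Taylor coefficients, by descending weight *)

Section Coefficients.
Variables (K : numFieldType) (al be ga b1 b2 b0 : K) (N : int).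
Variable c : int -> int -> int -> int -> K.
Hypothesis al_neq0 : al != 0.
Hypothesis disc : be ^+ 2 != 4 * al * ga.
Hypothesis c_out : forall a b k l : int,
  [|| a < 0, b < 0, k < 0 | l < 0] -> c a b k l = 0.
Hypothesis c_top : forall a b k l : int, N <= k + l -> c a b k l = 0.
Hypothesis c_rec : forall a b k l : int,
  (a + 1)%:~R * c (a + 1) b (k - 1) l + (b + 1)%:~R * c a (b + 1) k (l - 1)
  + (k - l)%:~R * (al * c (a - 2) b k l + be * c (a - 1) (b - 1) k l
      + ga * c a (b - 2) k l + b1 * c (a - 1) b k l + b2 * c a (b - 1) k l
      + b0 * c a b k l) = 0.
Hypothesis c_diag : forall k, c 0 0 k k = 0.

(* A Killing tensor of rank m on the plane has polynomial coefficients of degree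
   at most m. *)
Lemma killing_degree (m e : int) :
  (forall a b k l : int, k + l = m + 1 -> a + b = e - 1 ->
    (a + 1)%:~R * c (a + 1) b (k - 1) l + (b + 1)%:~R * c a (b + 1) k (l - 1) = 0) ->
  m < e -> forall a b k l : int, k + l = m -> a + b = e -> c a b k l = 0.
Proof.
move=> killing me.
have left_part : forall k a b l : int, k < b -> k + l = m -> a + b = e -> c a b k l = 0.
  apply: int_ind_neg => [k k0 a b l _ _ _|k k0 IHk a b l kb kl ab].
    by apply: c_out; lia.
  have := killing a (b - 1) k (l + 1) ltac:(lia) ltac:(lia).
  rewrite subrK addrK IHk ?mulr0 ?add0r; try lia.
  by move/eqP; rewrite mulf_eq0 intr_eq0 => /orP[|/eqP //]; lia.
have right_part : forall l a b k : int, l < a -> k + l = m -> a + b = e -> c a b k l = 0.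
  apply: int_ind_neg => [l l0 a b k _ _ _|l l0 IHl a b k la kl ab].
    by apply: c_out; lia.
  have := killing (a - 1) b (k + 1) l ltac:(lia) ltac:(lia).
  rewrite subrK addrK (IHl (a - 1)) ?mulr0 ?addr0; try lia.
  by move/eqP; rewrite mulf_eq0 intr_eq0 => /orP[|/eqP //]; lia.
(* Since [k + l < a + b], either [k < b] or [l < a]. *)
move=> a b k l kl ab; have [kb|bk] := ltP k b; first exact: left_part.
by apply: right_part => //; lia.
Qed.

(** Descending induction on the velocity degree. In the equation of velocity degree [k + l + 1] the
    field terms have at least the same weight, so they vanish by induction and the Killing equation
    remains; the bound on the weight and [k + l < N] give [k + l < a + b]. *)
Lemma weight_bound a b k l : 4 * N <= a + b + 3 * (k + l) -> c a b k l = 0.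
Proof.
have [m mkl] : exists m, k + l = N - m by exists (N - (k + l)); lia.
elim/int_ind_neg: m => [m m0|m m0 IHm] in a b k l mkl *.
  by move=> _; apply: c_top; lia.
move=> w; have [m1|m1] := ltP 0 m; last by apply: c_top; lia.
apply: (@killing_degree (k + l) (a + b)) => //; last first.
  by lia.
move=> a' b' k' l' kl' ab'; rewrite -[RHS](c_rec a' b' k' l').
rewrite (IHm (a' - 2)) ?(IHm (a' - 1)) ?(IHm a' (b' - 2)) ?(IHm a' (b' - 1) k' l')
  ?(IHm a' b' k' l').
  by rewrite !mulr0 !addr0 mulr0 addr0.
all: by lia.
Qed.

(** Two nested inductions: on the weight from above, each time for the current leading part [d], and
    within one weight on the layer [b + l], by [layer_eq0]. *)
Lemma coefficients_eq0 a b k l : c a b k l = 0.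
Proof.
suff H : forall m a b k l : int, a + b + 3 * (k + l) = 4 * N - m -> c a b k l = 0.
  by apply: (H (4 * N - (a + b + 3 * (k + l)))); lia.
move=> m; have [M] : exists M : int, m <= M by exists m.
elim/int_ind_neg: M m => [M M0 m mM|M M0 IHM m mM] {}a {}b {}k {}l w.
  by apply: weight_bound; lia.
have [mlt|mge] := ltP m M; first by apply: (IHM m); lia.
pose S := 4 * N - m; pose d b k l := c (S - b - 3 * k - 3 * l) b k l.
suff d0 : forall n b k l : int, b + l < n -> d b k l = 0.
  rewrite (_ : a = S - b - 3 * k - 3 * l); last by rewrite /S; lia.
  by apply: (d0 (b + l + 1)); lia.
have d_out : forall b k l : int,
    [|| b < 0, k < 0, l < 0 | S - b - 3 * k - 3 * l < 0] -> d b k l = 0.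
  by move=> b' k' l' h; apply: c_out; lia.
have high : forall a b k l : int, S < a + b + 3 * (k + l) -> c a b k l = 0.
  move=> a' b' k' l' h; apply: (IHM (4 * N - (a' + b' + 3 * (k' + l')))); rewrite /S in h; lia.
move=> {w}n {}b {}k {}l; elim/int_ind_neg: n b k l => [n n0|n n0 IHn] b k l bln.
  by have [b0'|b0'] := ltP b 0; apply: d_out; lia.
have [|bln1] := ltP (b + l) (n - 1); first exact: IHn.
apply: (@layer_eq0 K al be ga S d al_neq0 d_out _ disc _ (n - 1)) => //; try lia.
(* The offset 2 puts the quadratic field terms at weight [S]; those with [b1], [b2] and [b0] then
   have weight [S + 1] or [S + 2] and vanish. *)
- move=> b' k' l'; pose a' := S - b' - 3 * k' - 3 * l' + 2.
  rewrite -[RHS](c_rec a' b' k' l') /d.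
  rewrite (high (a' - 1) b') ?(high a' (b' - 1)) ?(high a' b'); try by rewrite /a'; lia.
  rewrite !mulr0 !addr0; congr (_%:~R * c _ _ _ _ + _ * c _ _ _ _
    + _ * (_ * c _ _ _ _ + _ * c _ _ _ _ + _ * c _ _ _ _)); rewrite /a'; lia.
- by move=> k' Sk; rewrite /d Sk -[RHS](c_diag k'); congr (c _ _ _ _); lia.
Qed.

End Coefficients.

(** * Complex coordinates for jets *)

Lemma iter_comm (T : Type) (f g : T -> T) n x :
  (forall y, f (g y) = g (f y)) -> iter n f (g x) = g (iter n f x).
Proof. by move=> fg; elim: n => //= n ->. Qed.

Section IterLinear.
Variables (K : pzRingType) (V : lmodType K) (D : V -> V).
Hypothesis D_lin : forall s u v, D (u + s *: v) = D u + s *: D v.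

Lemma iter_lin n s u v : iter n D (u + s *: v) = iter n D u + s *: iter n D v.
Proof. by elim: n => //= n ->. Qed.

(** Iterated form of the commutation relation [[D, X] = s]. At [n = 0] the truncated [n.-1] is
    harmless, its coefficient being 0. *)
Lemma iter_commutator (X : V -> V) s n u :
  (forall v, D (X v) = X (D v) + s *: v) ->
  iter n D (X u) = X (iter n D u) + (n%:R * s) *: iter n.-1 D u.
Proof.
move=> DX; elim: n => [|n IHn]; first by rewrite mul0r scale0r addr0.
rewrite iterS IHn D_lin DX -addrA; congr (_ + _).
case: n {IHn} => [|n]; first by rewrite mul0r scale0r addr0 mul1r.
by rewrite -!iterS -scalerDl (mulrS _ n.+1) mulrDl mul1r.
Qed.
End IterLinear.

Section Jets.
Variables (K : numFieldType) (im : K).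
Hypothesis im2 : im * im = -1.

(* A formal power series in (x_1, x_2, v_1, v_2), given by its derivatives at the
   origin. *)
Definition jet := nat -> nat -> nat -> nat -> K^o.

Implicit Types (u v : jet) (s t : K).

Definition jet_dx s u : jet := fun a b i j => u a.+1 b i j + s * u a b.+1 i j.
Definition jet_dv s u : jet := fun a b i j => u a b i.+1 j + s * u a b i j.+1.
(** Multiplication by a coordinate, by the Leibniz rule at the origin. *)
Definition jet_x1 u : jet := fun a b i j => a%:R * u a.-1 b i j.
Definition jet_x2 u : jet := fun a b i j => b%:R * u a b.-1 i j.
Definition jet_v1 u : jet := fun a b i j => i%:R * u a b i.-1 j.
Definition jet_v2 u : jet := fun a b i j => j%:R * u a b i j.-1.

Lemma jetP u v : (forall a b i j, u a b i j = v a b i j) -> u = v.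
Proof.
by move=> uv; apply/funext => a; apply/funext => b; apply/funext => i; apply/funext => j.
Qed.

Lemma jetDE s u v a b i j : (u + s *: v) a b i j = u a b i j + s * v a b i j.
Proof. by []. Qed.

Ltac jet_ext := apply: jetP => - [|?] [|?] [|?] [|?];
  rewrite ?jetDE /jet_dx /jet_dv /jet_x1 /jet_x2 /jet_v1 /jet_v2 ?jetDE /=; ring.

Lemma jet_dx_lin s t u v : jet_dx s (u + t *: v) = jet_dx s u + t *: jet_dx s v.
Proof. jet_ext. Qed.
Lemma jet_dv_lin s t u v : jet_dv s (u + t *: v) = jet_dv s u + t *: jet_dv s v.
Proof. jet_ext. Qed.
Lemma jet_dxx s t u : jet_dx s (jet_dx t u) = jet_dx t (jet_dx s u).
Proof. jet_ext. Qed.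
Lemma jet_dvv s t u : jet_dv s (jet_dv t u) = jet_dv t (jet_dv s u).
Proof. jet_ext. Qed.
Lemma jet_dvx s t u : jet_dv s (jet_dx t u) = jet_dx t (jet_dv s u).
Proof. jet_ext. Qed.
Lemma jet_dx_x1 s u : jet_dx s (jet_x1 u) = jet_x1 (jet_dx s u) + 1 *: u.
Proof. jet_ext. Qed.
Lemma jet_dx_x2 s u : jet_dx s (jet_x2 u) = jet_x2 (jet_dx s u) + s *: u.
Proof. jet_ext. Qed.
Lemma jet_dv_x1 s u : jet_dv s (jet_x1 u) = jet_x1 (jet_dv s u).
Proof. jet_ext. Qed.
Lemma jet_dv_x2 s u : jet_dv s (jet_x2 u) = jet_x2 (jet_dv s u).
Proof. jet_ext. Qed.
Lemma jet_dv_v1 s u : jet_dv s (jet_v1 u) = jet_v1 (jet_dv s u) + 1 *: u.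
Proof. jet_ext. Qed.
Lemma jet_dv_v2 s u : jet_dv s (jet_v2 u) = jet_v2 (jet_dv s u) + s *: u.
Proof. jet_ext. Qed.
Lemma jet_dx_v1 s u : jet_dx s (jet_v1 u) = jet_v1 (jet_dx s u).
Proof. jet_ext. Qed.
Lemma jet_dx_v2 s u : jet_dx s (jet_v2 u) = jet_v2 (jet_dx s u).
Proof. jet_ext. Qed.

(* Up to powers of 2, the derivatives with respect to z = x_1 + i x_2,
   w = v_1 + i v_2 and their conjugates. *)
Definition cjet u (a b k l : nat) : K :=
  iter a (jet_dx (- im)) (iter b (jet_dx im)
    (iter k (jet_dv (- im)) (iter l (jet_dv im) u))) 0 0 0 0.

Lemma cjetD u v s a b k l : cjet (u + s *: v) a b k l = cjet u a b k l + s * cjet v a b k l.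
Proof.
by rewrite /cjet !(iter_lin (jet_dv_lin _)) !(iter_lin (jet_dx_lin _)).
Qed.

Lemma cjet_dz u a b k l : cjet (jet_dx (- im) u) a b k l = cjet u a.+1 b k l.
Proof.
rewrite /cjet iterSr.
by rewrite !(iter_comm _ _ (jet_dvx _ _)) !(iter_comm _ _ (jet_dxx _ _)).
Qed.

Lemma cjet_dzb u a b k l : cjet (jet_dx im u) a b k l = cjet u a b.+1 k l.
Proof.
by rewrite /cjet iterSr !(iter_comm _ _ (jet_dvx _ _)).
Qed.

Lemma cjet_dw u a b k l : cjet (jet_dv (- im) u) a b k l = cjet u a b k.+1 l.
Proof. by rewrite /cjet iterSr (iter_comm _ _ (jet_dvv _ _)). Qed.

Lemma cjet_dwb u a b k l : cjet (jet_dv im u) a b k l = cjet u a b k l.+1.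
Proof. by rewrite /cjet iterSr. Qed.

Lemma cjet_x1 u a b k l :
  cjet (jet_x1 u) a b k l = a%:R * cjet u a.-1 b k l + b%:R * cjet u a b.-1 k l.
Proof.
rewrite /cjet !(iter_comm _ _ (jet_dv_x1 _)).
rewrite (iter_commutator (jet_dx_lin _) _ _ (jet_dx_x1 _)) (iter_lin (jet_dx_lin _)).
rewrite (iter_commutator (jet_dx_lin _) _ _ (jet_dx_x1 _)) !jetDE.
by rewrite {1}/jet_x1 mul0r add0r !mulr1.
Qed.

Lemma cjet_x2 u a b k l : cjet (jet_x2 u) a b k l =
  im * (b%:R * cjet u a b.-1 k l - a%:R * cjet u a.-1 b k l).
Proof.
rewrite /cjet !(iter_comm _ _ (jet_dv_x2 _)).
rewrite (iter_commutator (jet_dx_lin _) _ _ (jet_dx_x2 _)) (iter_lin (jet_dx_lin _)).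
rewrite (iter_commutator (jet_dx_lin _) _ _ (jet_dx_x2 _)) !jetDE.
by rewrite {1}/jet_x2 mul0r add0r; ring.
Qed.

Lemma cjet_v1 u a b k l :
  cjet (jet_v1 u) a b k l = k%:R * cjet u a b k.-1 l + l%:R * cjet u a b k l.-1.
Proof.
rewrite /cjet (iter_commutator (jet_dv_lin _) _ _ (jet_dv_v1 _)) (iter_lin (jet_dv_lin _)).
rewrite (iter_commutator (jet_dv_lin _) _ _ (jet_dv_v1 _)) !(iter_lin (jet_dx_lin _)).
by rewrite !(iter_comm _ _ (jet_dx_v1 _)) !jetDE {1}/jet_v1 mul0r add0r !mulr1.
Qed.

Lemma cjet_v2 u a b k l : cjet (jet_v2 u) a b k l =
  im * (l%:R * cjet u a b k l.-1 - k%:R * cjet u a b k.-1 l).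
Proof.
rewrite /cjet (iter_commutator (jet_dv_lin _) _ _ (jet_dv_v2 _)) (iter_lin (jet_dv_lin _)).
rewrite (iter_commutator (jet_dv_lin _) _ _ (jet_dv_v2 _)) !(iter_lin (jet_dx_lin _)).
by rewrite !(iter_comm _ _ (jet_dx_v2 _)) !jetDE {1}/jet_v2 mul0r add0r; ring.
Qed.

Definition jet_d1 u : jet := fun a b i j => u a.+1 b i j.
Definition jet_d2 u : jet := fun a b i j => u a b.+1 i j.
Definition jet_e1 u : jet := fun a b i j => u a b i.+1 j.
Definition jet_e2 u : jet := fun a b i j => u a b i j.+1.

Let im_neq0 : im != 0.
Proof.
apply/eqP => im0; move/eqP: im2; rewrite im0 mul0r eq_sym oppr_eq0 oner_eq0.
by [].
Qed.

Lemma cjetZ u s a b k l : cjet (s *: u) a b k l = s * cjet u a b k l.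
Proof.
have cjet0 : cjet 0 a b k l = 0.
  by apply: (@addrI _ (cjet 0 a b k l)); rewrite -{2}(mul1r (cjet 0 a b k l)) -cjetD scale1r !addr0.
by rewrite -[s *: u]add0r cjetD cjet0 add0r.
Qed.

Lemma cjet_d1 u a b k l :
  cjet (jet_d1 u) a b k l = 2^-1 * (cjet u a.+1 b k l + cjet u a b.+1 k l).
Proof.
rewrite -cjet_dz -cjet_dzb -[cjet (jet_dx im u) _ _ _ _]mul1r -cjetD -cjetZ.
congr cjet; apply: jetP => ? ? ? ?; rewrite /jet_d1 -[RHS]/(_ * (_ + _ * _)) /jet_dx /=.
by field.
Qed.

Lemma cjet_d2 u a b k l :
  cjet (jet_d2 u) a b k l = im / 2 * (cjet u a.+1 b k l - cjet u a b.+1 k l).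
Proof.
rewrite -cjet_dz -cjet_dzb -[- cjet _ _ _ _ _]mulN1r -cjetD -cjetZ.
congr cjet; apply: jetP => a' b' i j; rewrite /jet_d2 -[RHS]/(_ * (_ + _ * _)) /jet_dx /=.
by transitivity (- (im * im) * u a' b'.+1 i j); [rewrite im2 opprK mul1r|field].
Qed.

Lemma cjet_e1 u a b k l :
  cjet (jet_e1 u) a b k l = 2^-1 * (cjet u a b k.+1 l + cjet u a b k l.+1).
Proof.
rewrite -cjet_dw -cjet_dwb -[cjet (jet_dv im u) _ _ _ _]mul1r -cjetD -cjetZ.
congr cjet; apply: jetP => ? ? ? ?; rewrite /jet_e1 -[RHS]/(_ * (_ + _ * _)) /jet_dv /=.
by field.
Qed.

Lemma cjet_e2 u a b k l :
  cjet (jet_e2 u) a b k l = im / 2 * (cjet u a b k.+1 l - cjet u a b k l.+1).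
Proof.
rewrite -cjet_dw -cjet_dwb -[- cjet _ _ _ _ _]mulN1r -cjetD -cjetZ.
congr cjet; apply: jetP => a' b' i j; rewrite /jet_e2 -[RHS]/(_ * (_ + _ * _)) /jet_dv /=.
by transitivity (- (im * im) * u a' b' i j.+1); [rewrite im2 opprK mul1r|field].
Qed.

(** The real derivatives are combinations of the complex ones, so each can be peeled off while all
    complex derivatives stay 0. *)
Lemma cjet_inj u : (forall a b k l, cjet u a b k l = 0) -> forall a b i j, u a b i j = 0.
Proof.
move=> cu a b i j.
have u0 v : (forall a b k l, cjet v a b k l = 0) -> v 0 0 0 0 = 0 by move=> /(_ 0 0 0 0).
elim: a u cu => [|a IHa] u cu; last first.
  by apply: (IHa (jet_d1 u)) => *; rewrite cjet_d1 !cu addr0 mulr0.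
elim: b u cu => [|b IHb] u cu; last first.
  by apply: (IHb (jet_d2 u)) => *; rewrite cjet_d2 !cu subrr mulr0.
elim: i u cu => [|i IHi] u cu; last first.
  by apply: (IHi (jet_e1 u)) => *; rewrite cjet_e1 !cu addr0 mulr0.
elim: j u cu => [|j IHj] u cu; last first.
  by apply: (IHj (jet_e2 u)) => *; rewrite cjet_e2 !cu subrr mulr0.
exact: u0.
Qed.

(** * The equation of an integral in complex coordinates *)

Variables (q0 q1 q2 q11 q12 q22 : K) (N : nat) (u : jet).

Definition jet_field v : jet :=
  (q0 *: v + q1 *: jet_x1 v) + q2 *: jet_x2 v + q11 *: jet_x1 (jet_x1 v)
  + q12 *: jet_x1 (jet_x2 v) + q22 *: jet_x2 (jet_x2 v).

Definition jet_rot v : jet := jet_v1 (jet_e2 v) + (-1) *: jet_v2 (jet_e1 v).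

Hypothesis disc : q12 ^+ 2 != 4 * q11 * q22.
Hypothesis lead : q11 - q22 - im * q12 != 0.
Hypothesis u_top : forall a b i j, (N <= i + j)%N -> u a b i j = 0.
Hypothesis u_eq : forall a b i j,
  (jet_v1 (jet_d1 u) + 1 *: jet_v2 (jet_d2 u) + 1 *: jet_field (jet_rot u)) a b i j = 0.

(** Rotation of the velocity multiplies w and its conjugate by opposite phases, so its generator is
    diagonal in these coordinates. *)
Lemma cjet_rot v a b k l : cjet (jet_rot v) a b k l = im * (k%:R - l%:R) * cjet v a b k l.
Proof.
rewrite /jet_rot cjetD cjet_v1 cjet_v2 !cjet_e1 !cjet_e2.
case: k => [|k]; case: l => [|l] /=; by field.
Qed.

Lemma cjet_field v a b k l : cjet (jet_field v) a b k l =
  q0 * cjet v a b k l + (q1 - im * q2) * a%:R * cjet v a.-1 b k l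
  + (q1 + im * q2) * b%:R * cjet v a b.-1 k l
  + (q11 - q22 - im * q12) * (a%:R * a.-1%:R) * cjet v a.-2 b k l
  + 2 * (q11 + q22) * (a%:R * b%:R) * cjet v a.-1 b.-1 k l
  + (q11 - q22 + im * q12) * (b%:R * b.-1%:R) * cjet v a b.-2 k l.
Proof.
rewrite /jet_field !cjetD !cjetZ !(cjet_x1, cjet_x2).
set c1 := cjet v a b k l; set c2 := cjet v a.-1 b k l; set c3 := cjet v a b.-1 k l.
set c4 := cjet v a.-2 b k l; set c5 := cjet v a.-1 b.-1 k l; set c6 := cjet v a b.-2 k l.
have -> : im * (b%:R * (im * (b.-1%:R * c6 - a%:R * c5)) - a%:R * (im * (b%:R * c5 - a.-1%:R * c4)))
    = im * im * (b%:R * b.-1%:R * c6 - 2 * (a%:R * b%:R * c5) + a%:R * a.-1%:R * c4) by ring.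
by rewrite im2; ring.
Qed.

Lemma cjet_u_eq a b k l :
  k%:R * cjet u a.+1 b k.-1 l + l%:R * cjet u a b.+1 k l.-1
  + cjet (jet_field (jet_rot u)) a b k l = 0.
Proof.
have u_eq0 : jet_v1 (jet_d1 u) + 1 *: jet_v2 (jet_d2 u) + 1 *: jet_field (jet_rot u) = 0 *: u.
  by apply: jetP => *; rewrite u_eq; apply/esym/mul0r.
transitivity (cjet (0 *: u) a b k l); last by rewrite cjetZ mul0r.
rewrite -u_eq0 !cjetD cjet_v1 cjet_v2 !cjet_d1 !cjet_d2 !mul1r.
congr (_ + _).
set x1 := cjet u a.+1 b k.-1 l; set x2 := cjet u a b.+1 k.-1 l.
set x3 := cjet u a.+1 b k l.-1; set x4 := cjet u a b.+1 k l.-1.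
have -> : im * (l%:R * (im / 2 * (x3 - x4)) - k%:R * (im / 2 * (x1 - x2))) =
  im * im * (l%:R * (x3 - x4) - k%:R * (x1 - x2)) / 2 by ring.
by rewrite im2; field.
Qed.

Lemma cjet_u_top a b k l : (N <= k + l)%N -> cjet u a b k l = 0.
Proof.
rewrite /cjet => Nkl.
(* [m] counts the velocity derivatives taken so far; each lowers the degree bound by one. *)
have dv m s v : (forall a b i j, (N <= i + j + m)%N -> v a b i j = 0) ->
  (forall a b i j, (N <= i + j + m.+1)%N -> jet_dv s v a b i j = 0).
  by move=> v0 a' b' i j h; rewrite /jet_dv !v0 ?mulr0 ?addr0 //; lia.
have dx s v : (forall a b, v a b 0 0 = 0) -> (forall a b, jet_dx s v a b 0 0 = 0).
  by move=> v0 a' b'; rewrite /jet_dx !v0 ?mulr0 ?addr0.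
have iterdx s n v : (forall a b, v a b 0 0 = 0) -> (forall a b, iter n (jet_dx s) v a b 0 0 = 0).
  by move=> v0; elim: n => //= n IHn; apply: dx.
have iterdv s n m v : (forall a b i j, (N <= i + j + m)%N -> v a b i j = 0) ->
   (forall a b i j, (N <= i + j + (n + m))%N -> iter n (jet_dv s) v a b i j = 0).
  by move=> v0; elim: n => //= n IHn; rewrite addSn; apply: dv.
apply: (iterdx); apply: (iterdx) => a' b'; apply: (@iterdv _ _ l); last by lia.
move=> {}a' {}b' i j h; apply: (@iterdv _ _ 0); last by lia.
by move=> {h}*; apply: u_top; lia.
Qed.

(* The powers of v_1^2 + v_2^2 solve the recursion and drop out of it. *)
Definition offdiag_jet a b k l := if (a, b, k) == (0, 0, l) then 0 else cjet u a b k l.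

(** The removed entries occur only under the factor [k - l] with [k = l]; the transport terms carry
    a positive order in x and are unaffected. *)
Lemma offdiag_jet_rec a b k l : let c := offdiag_jet in
  k%:R * c a.+1 b k.-1 l + l%:R * c a b.+1 k l.-1 + (k%:R - l%:R) * (im * (
    q0 * c a b k l + (q1 - im * q2) * (a%:R * c a.-1 b k l)
    + (q1 + im * q2) * (b%:R * c a b.-1 k l)
    + (q11 - q22 - im * q12) * (a%:R * a.-1%:R * c a.-2 b k l)
    + 2 * (q11 + q22) * (a%:R * b%:R * c a.-1 b.-1 k l)
    + (q11 - q22 + im * q12) * (b%:R * b.-1%:R * c a b.-2 k l))) = 0.
Proof.
have := cjet_u_eq a b k l; rewrite cjet_field !cjet_rot /= /offdiag_jet !xpair_eqE /= andbF /=.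
have [<-|kl] := eqVneq k l.
  by rewrite subrr !(mulr0, mul0r, addr0).
by rewrite !andbF => <-; ring.
Qed.

(** The factorials turn derivatives into Taylor coefficients; integer indices with value 0 out of
    range spare the recursion its boundary cases. *)
Definition int_coef (f : nat -> nat -> nat -> nat -> K) (a b k l : int) : K :=
  match a, b, k, l with
  | Posz a, Posz b, Posz k, Posz l => f a b k l / (a`! * b`! * (k`! * l`!))%:R
  | _, _, _, _ => 0
  end.

Lemma int_coef_out f (a b k l : int) :
  [|| a < 0, b < 0, k < 0 | l < 0] -> int_coef f a b k l = 0.
Proof. by case: a b k l => [?|?] [?|?] [?|?] [?|?]. Qed.

Let fact0 n : (n`!)%:R != 0 :> K.
Proof. by rewrite pnatr_eq0 -lt0n fact_gt0. Qed.

Lemma int_coef_pred1 f (a b k l : nat) :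
  int_coef f (a%:Z - 1) b k l = a%:R * f a.-1 b k l / (a`! * b`! * (k`! * l`!))%:R.
Proof.
case: a => [|a]; first by rewrite int_coef_out // !mul0r.
rewrite -addn1 PoszD addrK addn1 /= factS !natrM.
by field; rewrite ?fact0 ?nat1r -?natrD ?pnatr_eq0.
Qed.

Lemma int_coef_pred2 f (a b k l : nat) :
  int_coef f a (b%:Z - 1) k l = b%:R * f a b.-1 k l / (a`! * b`! * (k`! * l`!))%:R.
Proof.
case: b => [|b]; first by rewrite int_coef_out // !mul0r.
rewrite -addn1 PoszD addrK addn1 /= factS !natrM.
by field; rewrite ?fact0 ?nat1r -?natrD ?pnatr_eq0.
Qed.

Lemma int_coef_up1 f (a b k l : nat) : (a%:Z + 1)%:~R * int_coef f (a%:Z + 1) b (k%:Z - 1) l =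
  k%:R * f a.+1 b k.-1 l / (a`! * b`! * (k`! * l`!))%:R.
Proof.
case: k => [|k]; first by rewrite int_coef_out ?orbT // !mul0r mulr0.
have -> : k.+1%:Z - 1 = k by lia.
have -> : a%:Z + 1 = a.+1 by lia.
rewrite /= !factS !natrM.
by field; rewrite ?fact0 ?nat1r -?natrD ?pnatr_eq0.
Qed.

Lemma int_coef_up2 f (a b k l : nat) : (b%:Z + 1)%:~R * int_coef f a (b%:Z + 1) k (l%:Z - 1) =
  l%:R * f a b.+1 k l.-1 / (a`! * b`! * (k`! * l`!))%:R.
Proof.
case: l => [|l]; first by rewrite int_coef_out ?orbT // !mul0r mulr0.
have -> : l.+1%:Z - 1 = l by lia.
have -> : b%:Z + 1 = b.+1 by lia.
rewrite /= !factS !natrM.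
by field; rewrite ?fact0 ?nat1r -?natrD ?pnatr_eq0.
Qed.

Lemma int_coef_pred11 f (a b k l : nat) : int_coef f (a%:Z - 2) b k l =
  a%:R * a.-1%:R * f a.-2 b k l / (a`! * b`! * (k`! * l`!))%:R.
Proof.
case: a => [|[|a]]; try by rewrite int_coef_out // !(mulr0, mul0r).
rewrite -addn2 PoszD addrK addn2 /= !factS !natrM.
by field; rewrite ?fact0 ?nat1r -?natrD ?pnatr_eq0.
Qed.

Lemma int_coef_pred22 f (a b k l : nat) : int_coef f a (b%:Z - 2) k l =
  b%:R * b.-1%:R * f a b.-2 k l / (a`! * b`! * (k`! * l`!))%:R.
Proof.
case: b => [|[|b]]; try by rewrite int_coef_out ?orbT // !(mulr0, mul0r).
rewrite -addn2 PoszD addrK addn2 /= !factS !natrM.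
by field; rewrite ?fact0 ?nat1r -?natrD ?pnatr_eq0.
Qed.

Lemma int_coef_pred12 f (a b k l : nat) : int_coef f (a%:Z - 1) (b%:Z - 1) k l =
  a%:R * b%:R * f a.-1 b.-1 k l / (a`! * b`! * (k`! * l`!))%:R.
Proof.
case: a => [|a]; first by rewrite int_coef_out // !(mulr0, mul0r).
case: b => [|b]; first by rewrite int_coef_out ?orbT // !(mulr0, mul0r).
have -> : a.+1%:Z - 1 = a by lia.
have -> : b.+1%:Z - 1 = b by lia.
rewrite /= !factS !natrM.
by field; rewrite ?fact0 ?nat1r -?natrD ?pnatr_eq0.
Qed.

Lemma int_offdiag_rec (a b k l : int) : let c := int_coef offdiag_jet in
  (a + 1)%:~R * c (a + 1) b (k - 1) l + (b + 1)%:~R * c a (b + 1) k (l - 1)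
  + (k - l)%:~R * (im * (q11 - q22 - im * q12) * c (a - 2) b k l
    + im * (2 * (q11 + q22)) * c (a - 1) (b - 1) k l
    + im * (q11 - q22 + im * q12) * c a (b - 2) k l
    + im * (q1 - im * q2) * c (a - 1) b k l + im * (q1 + im * q2) * c a (b - 1) k l
    + im * q0 * c a b k l) = 0.
Proof.
move=> c; have out := int_coef_out offdiag_jet.
have [neg|] := boolP [|| a < 0, b < 0, k < 0 | l < 0].
  rewrite /c (out (a - 2)) ?(out (a - 1)) ?(out a (b - 2)) ?(out a (b - 1) k) ?(out a b k); try lia.
  rewrite !(mulr0, addr0).
  (* Out of range only a transport term could survive, at [a = -1] or [b = -1], and there its factor
     is 0. *)
  have [->|a1] := eqVneq (a + 1) 0; last rewrite (out (a + 1)) ?mulr0; try lia.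
    have [->|b1] := eqVneq (b + 1) 0; last rewrite (out _ (b + 1)) ?mulr0; try lia.
      by rewrite !mul0r addr0.
    by rewrite mul0r addr0.
  have [->|b1] := eqVneq (b + 1) 0; last rewrite (out _ (b + 1)) ?mulr0; try lia.
    by rewrite mul0r addr0.
  by rewrite addr0.
rewrite !negb_or -!leNgt; case: a b k l => [a|?] [b|?] [k|?] [l|?] // _.
rewrite /c int_coef_up1 int_coef_up2 int_coef_pred1 int_coef_pred2 int_coef_pred11
  int_coef_pred22 int_coef_pred12 /=.
rewrite -[RHS](mul0r (a`! * b`! * (k`! * l`!))%:R^-1) -(offdiag_jet_rec a b k l) /=.
by rewrite rmorphB /=; ring.
Qed.

(** In complex coordinates the discriminant of the quadratic part is 4 times the real one, so [disc]
    is what [coefficients_eq0] asks for. *)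
Lemma cjet_u_eq0 a b k l : (a, b, k) != (0, 0, l) -> cjet u a b k l = 0.
Proof.
move=> abkl.
have : int_coef offdiag_jet a b k l = 0.
  apply: (@coefficients_eq0 K (im * (q11 - q22 - im * q12)) (im * (2 * (q11 + q22)))
    (im * (q11 - q22 + im * q12)) (im * (q1 - im * q2)) (im * (q1 + im * q2)) (im * q0) N).
  - by rewrite mulf_neq0 // im_neq0.
  - rewrite -subr_eq0.
    have -> : (im * (2 * (q11 + q22))) ^+ 2 - 4 * (im * (q11 - q22 - im * q12)) *
        (im * (q11 - q22 + im * q12)) =
        4 * (im * im) * (4 * q11 * q22 + im * im * q12 ^+ 2) by ring.
    by rewrite im2 !mulf_neq0 ?oppr_eq0 ?oner_eq0 ?pnatr_eq0 // mulN1r subr_eq0 eq_sym.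
  - exact: int_coef_out.
  - case=> [?|?] [?|?] [?|?] [?|?] //= h; rewrite /offdiag_jet; case: ifP => [_|_].
      by rewrite mul0r.
    by rewrite cjet_u_top ?mul0r //; lia.
  - exact: int_offdiag_rec.
  - by case=> //= ?; rewrite /offdiag_jet eqxx mul0r.
rewrite /= /offdiag_jet (negPf abkl) => /eqP.
by rewrite mulf_eq0 invr_eq0 !natrM !mulf_eq0 !(negPf (fact0 _)) !orbF => /eqP.
Qed.

(** Only the powers of w wb survive; these are free of x and invariant under rotation of the
    velocity. *)
Lemma jet_rigid a b i j :
  [/\ u a.+1 b i j = 0, u a b.+1 i j = 0 & jet_rot u a b i j = 0].
Proof.
have cu0 (a' b' k l : nat) : (0 < a' + b')%N -> cjet u a' b' k l = 0.
  by move=> ab; apply: cjet_u_eq0; rewrite !xpair_eqE; move: ab; case: a' b' => [|?] [].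
split.
- by apply: (@cjet_inj (jet_d1 u)) => *; rewrite cjet_d1 !cu0 ?addr0 ?mulr0 //; lia.
- by apply: (@cjet_inj (jet_d2 u)) => *; rewrite cjet_d2 !cu0 ?subrr ?mulr0 //; lia.
- apply: cjet_inj => a' b' k l; rewrite cjet_rot; have [->|kl] := eqVneq k l.
    by rewrite subrr mulr0 mul0r.
  by rewrite cjet_u_eq0 ?mulr0 // !xpair_eqE (negPf kl) !andbF.
Qed.

End Jets.

(** * Smooth functions *)

Section Smooth.
Variables (R : realType) (V : normedModType R).
Implicit Types (f g : V -> R) (u v x y : V) (k : nat).

Lemma is_derive_line f y v (t : R) : derivable f (y + t *: v) v ->
  is_derive t (1 : R) (fun s : R => f (y + s *: v)) ('D_v f (y + t *: v)).
Proof.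
have E : (fun h : R => h^-1 *: (f (h *: v + (y + t *: v)) - f (y + t *: v))) =
  (fun h : R => h^-1 *: (f (y + (h *: (1 : R) + t) *: v) - f (y + t *: v))).
  apply/funext => h; congr (_ *: (f _ - _)).
  by rewrite scalerDl [h *: 1]mulr1 addrCA.
rewrite /derivable /derive /= E => df; split; first exact: df.
by rewrite /derive /=.
Qed.

Lemma line_mvt f y v (h : R) : 0 < h -> (forall x, differentiable f x) ->
  exists2 t, 0 < t < h & f (y + h *: v) - f y = h * 'D_v f (y + t *: v).
Proof.
move=> h0 df.
have dl (t : R) : is_derive t (1 : R) (fun s : R => f (y + s *: v)) ('D_v f (y + t *: v)).
  by apply: is_derive_line; exact: diff_derivable.
have [|t] := MVT h0 (fun t _ => dl t).
  by apply: derivable_within_continuous => t _; apply: ex_derive.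
rewrite in_itv /= scale0r addr0 subr0 => th ->.
by exists t => //; rewrite mulrC.
Qed.

Lemma derive_translate f y c v : 'D_v (fun x => f (x + c)) y = 'D_v f (y + c).
Proof.
rewrite /derive (_ : (fun h : R => _) =
  fun h : R => h^-1 *: ((f \o shift (y + c)) (h *: v) - f (y + c))) //.
by apply/funext => h /=; rewrite addrA.
Qed.

(** The mean value theorem is applied twice: along [v] to the increment of [f] in direction [u],
    then along [u] to ['D_v f]. *)
Lemma second_difference f u v x (h : R) : 0 < h -> (forall y, differentiable f y) ->
  (forall y, differentiable ('D_v f) y) ->
  exists s t : R, [/\ 0 < s < h, 0 < t < h &
    f (x + h *: v + h *: u) - f (x + h *: v) - (f (x + h *: u) - f x)
    = h * (h * 'D_u ('D_v f) (x + s *: v + t *: u))].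
Proof.
move=> h0 df dvf.
have dfu y : differentiable (fun z => f (z + h *: u)) y.
  by apply: (@differentiable_comp _ _ _ _ (fun z => z + h *: u)) => //; exact: differentiableD.
have [s sh] := @line_mvt ((fun z => f (z + h *: u)) - f) x v h h0
  (fun y => differentiableB (dfu y) (df y)).
rewrite deriveB; [|exact: diff_derivable..].
rewrite derive_translate => e1.
have [t th e2] := @line_mvt ('D_v f) (x + s *: v) u h h0 dvf.
exists s, t; split=> //; rewrite -e2 -e1 !fctE.
by [].
Qed.

(** The second difference is symmetric in [u] and [v], so both orders of differentiation compute
    it. *)
Lemma mixed_differences f u v x (h : R) : 0 < h -> Ck 2 f ->
  exists s t s' t' : R, [/\ 0 < s < h, 0 < t < h, 0 < s' < h, 0 < t' < h &
    'D_u ('D_v f) (x + s *: v + t *: u) = 'D_v ('D_u f) (x + s' *: u + t' *: v)].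
Proof.
move=> h0 [df d2f].
have [s [t [sh th e1]]] := second_difference u x h0 df (d2f v).1.
have [s' [t' [sh' th' e2]]] := second_difference v x h0 df (d2f u).1.
exists s, t, s', t'; split; [exact: sh|exact: th|exact: sh'|exact: th'|].
apply: (mulfI (lt0r_neq0 h0)); apply: (mulfI (lt0r_neq0 h0)).
apply: etrans (esym e1) (etrans _ e2); rewrite (addrAC x).
have swap (p a b c : R) : p - a - (b - c) = p - b - (a - c) by ring.
exact: swap.
Qed.

Lemma continuous_eq_of_near (A B : V -> R) u v x :
  {for x, continuous A} -> {for x, continuous B} ->
  (forall h : R, 0 < h -> exists s t s' t' : R,
    [/\ 0 < s < h, 0 < t < h, 0 < s' < h, 0 < t' < h &
      A (x + s *: v + t *: u) = B (x + s' *: u + t' *: v)]) ->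
  A x = B x.
Proof.
move=> cA cB mixed.
apply/eqP; rewrite -subr_eq0 -normr_eq0; apply/eqP/le_anti/andP; split => //.
apply/ler_addgt0Pl => e e0; rewrite addr0.
have e20 : 0 < e / 2 by rewrite divr_gt0.
have nA : \forall y \near x, `|A x - A y| < e / 2 by move/cvgrPdist_lt: (cA) => h; exact: h.
have nB : \forall y \near x, `|B x - B y| < e / 2 by move/cvgrPdist_lt: (cB) => h; exact: h.
have [r /= r0 rAB] := (nbhs_ballP _ _).1 (filterI nA nB).
(* Small enough to keep both intermediate points in the ball of radius [r]; the 1 covers
   [u = v = 0]. *)
pose h := r / (`|u| + `|v| + 1).
have uv0 : 0 < `|u| + `|v| + 1 by rewrite ltr_wpDl // addr_ge0.
have h0 : 0 < h by rewrite divr_gt0.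
have near_x s t p q : 0 < s < h -> 0 < t < h -> `|p| + `|q| = `|u| + `|v| ->
    ball x r (x + s *: p + t *: q).
  move=> /andP[s0 sh] /andP[t0 th] pq; rewrite -ball_normE /ball_ /=.
  rewrite -addrA opprD addrA subrr sub0r normrN (le_lt_trans (ler_normD _ _)) //.
  rewrite !normrZ !gtr0_norm //.
  apply: (@le_lt_trans _ _ (h * (`|u| + `|v|))).
    by rewrite -pq mulrDr lerD // ler_wpM2r // ltW.
  by rewrite /h mulrAC ltr_pdivrMr // ltr_pM2l // ltrDl.
have [s [t [s' [t' [sh th sh' th' AB]]]]] := mixed h h0.
have [Ay _] := rAB _ (near_x s t v u sh th (addrC _ _)).
have [_] := rAB _ (near_x s' t' u v sh' th' erefl).
rewrite -AB distrC => By.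
rewrite (splitr e) (le_trans _ (ltW (ltrD Ay By))) // (le_trans _ (ler_normD _ _)) //.
by rewrite addrA subrK.
Qed.

(** Schwarz's theorem, by letting [h] tend to 0 in [mixed_differences]. *)
Lemma deriveC f u v x : Ck 2 f -> 'D_u ('D_v f) x = 'D_v ('D_u f) x.
Proof.
move=> C2f; apply: (@continuous_eq_of_near ('D_u ('D_v f)) ('D_v ('D_u f)) u v x).
- exact: (C2f.2 v).2.
- exact: (C2f.2 u).2.
- by move=> h h0; exact: mixed_differences.
Qed.

Lemma Ck_pred k f : Ck k.+1 f -> Ck k f.
Proof.
elim: k f => [|k IHk] f; first by case=> df _ x; apply: differentiable_continuous.
by move=> [df dvf]; split=> // v; apply: IHk.
Qed.

Lemma Ck_cst k (c : R) : Ck k (fun _ : V => c).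
Proof.
elim: k c => [|k IHk] c /=; first exact: cst_continuous.
split=> [x|v]; first exact: differentiable_cst.
rewrite (_ : 'D_v (fun=> c) = fun=> 0); first exact: IHk.
by apply/funext => x; rewrite derive_cst.
Qed.

Lemma CkD k f g : Ck k f -> Ck k g -> Ck k (f \+ g).
Proof.
elim: k f g => [|k IHk] f g /=.
  by move=> cf cg x; apply: continuousD; [exact: cf|exact: cg].
move=> [df dvf] [dg dvg]; split=> [x|v]; first exact: differentiableD.
rewrite (_ : 'D_v (f \+ g) = ('D_v f) \+ ('D_v g)); first exact: IHk.
by apply/funext => x; rewrite deriveD //; exact: diff_derivable.
Qed.

Lemma CkM k f g : Ck k f -> Ck k g -> Ck k (f \* g).
Proof.
elim: k f g => [|k IHk] f g.
  by move=> cf cg x; apply: continuousM; [exact: cf|exact: cg].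
move=> Cf Cg; have [[df dvf] [dg dvg]] := (Cf, Cg); split=> [x|v]; first exact: differentiableM.
rewrite (_ : 'D_v (f \* g) = (f \* 'D_v g) \+ (g \* 'D_v f)).
  by apply: CkD; apply: IHk; [exact: (Ck_pred Cf)|exact: dvg|exact: (Ck_pred Cg)|exact: dvf].
by apply/funext => x; rewrite deriveM //; exact: diff_derivable.
Qed.

Lemma smooth_cst (c : R) : smooth (fun _ : V => c).
Proof. by move=> k; exact: Ck_cst. Qed.

Lemma smoothD f g : smooth f -> smooth g -> smooth (f \+ g).
Proof. by move=> sf sg k; exact: CkD. Qed.

Lemma smoothM f g : smooth f -> smooth g -> smooth (f \* g).
Proof. by move=> sf sg k; exact: CkM. Qed.

Lemma smooth_derive f v : smooth f -> smooth ('D_v f).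
Proof. by move=> sf k; have [_ dvf] := sf k.+1; exact: dvf. Qed.

Lemma smooth_differentiable f x : smooth f -> differentiable f x.
Proof. by move=> /(_ 1%N) [df _]; exact: df. Qed.

Lemma smooth_derivable f x v : smooth f -> derivable f x v.
Proof. by move=> sf; apply: diff_derivable; exact: smooth_differentiable. Qed.

Lemma smooth_sum (I : Type) (r : seq I) (P : pred I) (F : I -> V -> R) :
  (forall i, smooth (F i)) -> smooth (fun x => \sum_(i <- r | P i) F i x).
Proof.
move=> sF; elim: r => [|i r IHr].
  by rewrite (_ : (fun x => _) = fun=> 0); [exact: smooth_cst|apply/funext => x; rewrite big_nil].
rewrite (_ : (fun x => _) = if P i then F i \+ (fun x => \sum_(i <- r | P i) F i x) else
  (fun x => \sum_(i <- r | P i) F i x)).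
  by case: ifP => // _; exact: smoothD.
by apply/funext => x; rewrite big_cons; case: ifP.
Qed.

End Smooth.

Section IteratedDerivatives.
Variables (R : realType) (V : normedModType R).
Implicit Types (f g : V -> R) (u v x : V).

Lemma smooth_iter f v n : smooth f -> smooth (iter n (fun g => 'D_v g) f).
Proof. by move=> sf; elim: n => //= n; exact: smooth_derive. Qed.

Lemma iter_deriveD f g v n : smooth f -> smooth g ->
  iter n (fun g => 'D_v g) (f \+ g) =
  iter n (fun g => 'D_v g) f \+ iter n (fun g => 'D_v g) g.
Proof.
move=> sf sg; elim: n => //= n ->; apply/funext => x /=.
by rewrite deriveD //; exact: smooth_derivable (smooth_iter _ _ _).
Qed.

Lemma iter_deriveZ (c : R) f v n : smooth f ->
  iter n (fun g => 'D_v g) (fun x => c * f x) =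
  (fun x => c * iter n (fun g => 'D_v g) f x).
Proof.
move=> sf; elim: n => //= n ->; apply/funext => x /=.
by apply: (@deriveZ _ _ R); exact: smooth_derivable (smooth_iter _ _ _).
Qed.

Lemma iter_deriveC f u v m n : smooth f ->
  iter m (fun g => 'D_u g) (iter n (fun g => 'D_v g) f) =
  iter n (fun g => 'D_v g) (iter m (fun g => 'D_u g) f).
Proof.
have one k g : smooth g -> 'D_u (iter k (fun g => 'D_v g) g) = iter k (fun g => 'D_v g) ('D_u g).
  move=> sg; elim: k => //= k <-; apply/funext => x.
  by apply: deriveC; exact: smooth_iter.
by move=> sf; elim: m => //= m ->; apply: one; exact: smooth_iter.
Qed.

Lemma iter_deriveM (X f : V -> R) (s : R) v n : smooth f -> smooth X ->
  (forall x, 'D_v X x = s) ->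
  iter n (fun g => 'D_v g) (X \* f) = (fun x => X x * iter n (fun g => 'D_v g) f x +
    n%:R * s * iter n.-1 (fun g => 'D_v g) f x).
Proof.
move=> sf sX dX; elim: n => [|n IHn]; first by apply/funext => x /=; rewrite !mul0r addr0.
rewrite iterS IHn; apply/funext => x.
have si m := smooth_iter v m sf.
have dX1 : derivable X x v by exact: smooth_derivable.
have dXf : derivable (X \* iter n (fun g => 'D_v g) f) x v.
  by apply: smooth_derivable; apply: smoothM; [exact: sX|exact: si].
have di : derivable (iter n.-1 (fun g => 'D_v g) f) x v by exact: smooth_derivable (si _).
have df : derivable (iter n (fun g => 'D_v g) f) x v by exact: smooth_derivable (si _).
have dZ : derivable (fun y => n%:R * s * iter n.-1 (fun g => 'D_v g) f y) x v.
  exact: derivableZ.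
rewrite (@deriveD _ _ _ (X \* iter n (fun g => 'D_v g) f)
  (fun y => n%:R * s * iter n.-1 (fun g => 'D_v g) f y) x v dXf dZ).
rewrite (@deriveM _ _ X _ x v dX1 df) (@deriveZ _ _ R _ (n%:R * s) x v di) dX /=.
rewrite -![_ *: _]/(_ * _).
case: n {IHn dXf di df dZ} => [|n] /=; first by rewrite !mul0r; ring.
by rewrite (mulrS _ n.+1); ring.
Qed.

End IteratedDerivatives.

(** * Jets of functions on the plane *)

Section PlaneJets.
Variable R : realType.
Implicit Types (f g : R * R -> R) (x y : R * R).

Lemma is_diff_fst x : is_diff x (fst : R * R -> R) (fst : R * R -> R).
Proof.
pose L : {linear (R * R)%type -> R} := HB.pack (fst : R * R -> R)
  (GRing.isLinear.Build _ _ _ _ (fst : R * R -> R) (fun _ _ _ => erefl)).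
have cL : continuous L by move=> y; exact: cvg_fst.
have -> : (fst : R * R -> R) = L by [].
by split; [exact: linear_differentiable|exact: diff_lin].
Qed.

Lemma is_diff_snd x : is_diff x (snd : R * R -> R) (snd : R * R -> R).
Proof.
pose L : {linear (R * R)%type -> R} := HB.pack (snd : R * R -> R)
  (GRing.isLinear.Build _ _ _ _ (snd : R * R -> R) (fun _ _ _ => erefl)).
have cL : continuous L by move=> y; exact: cvg_snd.
have -> : (snd : R * R -> R) = L by [].
by split; [exact: linear_differentiable|exact: diff_lin].
Qed.

Lemma derive_fst x v : 'D_v (fst : R * R -> R) x = v.1.
Proof. by have dx := is_diff_fst x; rewrite deriveE // diff_val. Qed.

Lemma derive_snd x v : 'D_v (snd : R * R -> R) x = v.2.
Proof. by have dx := is_diff_snd x; rewrite deriveE // diff_val. Qed.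

Lemma smooth_fst : smooth (fst : R * R -> R).
Proof.
have dfst x : differentiable (fst : R * R -> R) x by have dx := is_diff_fst x.
case=> [|k] /=; first by move=> x; exact: differentiable_continuous.
split=> // v; rewrite (_ : (fun x => _) = fun=> v.1); first exact: Ck_cst.
by apply/funext => x; exact: derive_fst.
Qed.

Lemma smooth_snd : smooth (snd : R * R -> R).
Proof.
have dsnd x : differentiable (snd : R * R -> R) x by have dx := is_diff_snd x.
case=> [|k] /=; first by move=> x; exact: differentiable_continuous.
split=> // v; rewrite (_ : (fun x => _) = fun=> v.2); first exact: Ck_cst.
by apply/funext => x; exact: derive_snd.
Qed.

Definition plane_jet f x (a b : nat) : R :=
  iter a (fun g => 'D_(1, 0) g) (iter b (fun g => 'D_(0, 1) g) f) x.

Lemma plane_jet_dx f x a b : smooth f -> plane_jet ('D_(1, 0) f) x a b = plane_jet f x a.+1 b.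
Proof.
move=> sf; rewrite /plane_jet (iterSr a); congr (iter a _ _ x).
by rewrite -(iter_deriveC _ _ 1).
Qed.

Lemma plane_jet_dy f x a b : plane_jet ('D_(0, 1) f) x a b = plane_jet f x a b.+1.
Proof. by rewrite /plane_jet (iterSr b). Qed.

Lemma plane_jetD f g x a b : smooth f -> smooth g ->
  plane_jet (f \+ g) x a b = plane_jet f x a b + plane_jet g x a b.
Proof.
by move=> sf sg; rewrite /plane_jet !iter_deriveD //; exact: smooth_iter.
Qed.

Lemma plane_jetZ (c : R) f x a b : smooth f ->
  plane_jet (fun x => c * f x) x a b = c * plane_jet f x a b.
Proof.
by move=> sf; rewrite /plane_jet !iter_deriveZ //; exact: smooth_iter.
Qed.

Lemma smooth_shift_fst (c : R) : smooth (fun x : R * R => x.1 - c).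
Proof. exact: smoothD smooth_fst (smooth_cst _ (- c)). Qed.

Lemma smooth_shift_snd (c : R) : smooth (fun x : R * R => x.2 - c).
Proof. exact: smoothD smooth_snd (smooth_cst _ (- c)). Qed.

Lemma derive_shift_fst (c : R) x v : 'D_v (fun x : R * R => x.1 - c) x = v.1.
Proof.
rewrite (@deriveB _ _ _ fst (fun=> c)) ?derive_fst ?derive_cst ?subr0 //.
exact: smooth_derivable smooth_fst.
Qed.

Lemma derive_shift_snd (c : R) x v : 'D_v (fun x : R * R => x.2 - c) x = v.2.
Proof.
rewrite (@deriveB _ _ _ snd (fun=> c)) ?derive_snd ?derive_cst ?subr0 //.
exact: smooth_derivable smooth_snd.
Qed.

Lemma plane_jet_mul1 f x a b : smooth f ->
  plane_jet (fun y => (y.1 - x.1) * f y) x a b = a%:R * plane_jet f x a.-1 b.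
Proof.
move=> sf; rewrite /plane_jet.
rewrite (@iter_deriveM _ _ (fun y => y.1 - x.1) f 0) //; last 2 first.
- exact: smooth_shift_fst.
- by move=> y; rewrite derive_shift_fst.
rewrite (_ : (fun y => _) =
    (fun y => y.1 - x.1) \* iter b (fun g => 'D_(0, 1) g) f); last first.
  by apply/funext => y /=; rewrite mulr0 mul0r addr0.
rewrite (@iter_deriveM _ _ (fun y => y.1 - x.1) _ 1) ?subrr ?mul0r ?add0r ?mulr1 //.
- exact: smooth_iter.
- exact: smooth_shift_fst.
- by move=> y; rewrite derive_shift_fst.
Qed.

Lemma plane_jet_mul2 f x a b : smooth f ->
  plane_jet (fun y => (y.2 - x.2) * f y) x a b = b%:R * plane_jet f x a b.-1.
Proof.
move=> sf; rewrite /plane_jet.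
rewrite (@iter_deriveM _ _ (fun y => y.2 - x.2) f 1) //; last 2 first.
- exact: smooth_shift_snd.
- by move=> y; rewrite derive_shift_snd.
rewrite (_ : (fun y => _) = ((fun y => y.2 - x.2) \* iter b (fun g => 'D_(0, 1) g) f)
    \+ (fun y => b%:R * iter b.-1 (fun g => 'D_(0, 1) g) f y)); last first.
  by apply/funext => y /=; rewrite mulr1.
rewrite iter_deriveD; last 2 first.
- by apply: smoothM; [exact: smooth_shift_snd|exact: smooth_iter].
- by apply: (@smoothM _ _ (fun=> b%:R)); [exact: smooth_cst|exact: smooth_iter].
rewrite iter_deriveZ; last exact: smooth_iter.
rewrite (@iter_deriveM _ _ (fun y => y.2 - x.2) _ 0) /=; last 3 first.
- exact: smooth_iter.
- exact: smooth_shift_snd.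
- by move=> y; rewrite derive_shift_snd.
by rewrite subrr mul0r mulr0 mul0r !add0r.
Qed.

End PlaneJets.

(** * Integrals of the planar magnetic motion *)

Section PlaneIntegrals.
Variables (R : realType) (p3 p4 p5 p6 p7 p8 : R).

Definition magnetic_field (x : R * R) : R :=
  p3 + x.1 * p4 + x.2 * p5 + 2^-1 * x.1 ^+ 2 * p6 + x.1 * x.2 * p7 + 2^-1 * x.2 ^+ 2 * p8.

Variables (N : nat) (g : nat -> nat -> R * R -> R).
Hypothesis p7_neq0 : p7 != 0.
Hypothesis p_disc : p7 ^+ 2 != p6 * p8.
Hypothesis g_smooth : forall i j, smooth (g i j).
Hypothesis g_top : forall i j x, (N <= i + j)%N -> g i j x = 0.

Definition rotation (i j : nat) (x : R * R) : R :=
  i%:R * g i.-1 j.+1 x - j%:R * g i.+1 j.-1 x.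

Hypothesis g_eq : forall i j x,
  i%:R * 'D_(1, 0) (g i.-1 j) x + j%:R * 'D_(0, 1) (g i j.-1) x
  + magnetic_field x * rotation i j x = 0.

Lemma smoothZ (c : R) (f : R * R -> R) : smooth f -> smooth (fun x => c * f x).
Proof. by move=> sf; apply: (@smoothM _ _ (fun=> c)) => //; exact: smooth_cst. Qed.

(** The field is quadratic, so its expansion around [x] is exact and the jets of the [g i j] at [x]
    satisfy the equation of [jet_rigid]. They are complexified to supply a square root of -1. *)
Lemma plane_rigid i j x :
  [/\ 'D_(1, 0) (g i j) x = 0, 'D_(0, 1) (g i j) x = 0 & rotation i j x = 0].
Proof.
pose u : jet R[i] := fun a b i j => (plane_jet (g i j) x a b)%:C%C.
(* The gradient of the field at [x]. *)
pose b1 := p4 + x.1 * p6 + x.2 * p7; pose b2 := p5 + x.1 * p7 + x.2 * p8.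
have jet_rotE a b k l : jet_rot u a b k l = (plane_jet (rotation k l) x a b)%:C%C.
  rewrite (_ : rotation k l = (fun x => k%:R * g k.-1 l.+1 x) \+
      (fun x => - l%:R * g k.+1 l.-1 x)); last first.
    by apply/funext => y; rewrite /rotation /= mulNr.
  rewrite plane_jetD ?plane_jetZ; try exact: smoothZ; try exact: g_smooth.
  rewrite rmorphD !rmorphM rmorphN !rmorph_nat /=.
  by rewrite /jet_rot /jet_v1 /jet_v2 /jet_e1 /jet_e2 jetDE mulN1r mulNr.
have rot_smooth k l : smooth (rotation k l).
  apply: (@smoothD _ _ (fun x => k%:R * g k.-1 l.+1 x)
      (fun x => - (l%:R * g k.+1 l.-1 x))).
    exact: smoothZ.
  rewrite (_ : (fun x => _) = (fun x => - l%:R * g k.+1 l.-1 x)); first exact: smoothZ.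
  by apply/funext => y; rewrite mulNr.
have u_eq a b k l : (jet_v1 (jet_d1 u) + 1 *: jet_v2 (jet_d2 u) +
    1 *: jet_field (magnetic_field x)%:C%C b1%:C%C b2%:C%C (p6 / 2)%:C%C p7%:C%C
      (p8 / 2)%:C%C (jet_rot u)) a b k l = 0.
  (* The zero on the right is written [0 * rotation k l y] so that [plane_jetZ] evaluates its
     jet. *)
  have pde : (fun y => k%:R * 'D_(1, 0) (g k.-1 l) y) \+ (fun y => l%:R * 'D_(0, 1) (g k l.-1) y)
      \+ ((fun y => magnetic_field x * rotation k l y)
      \+ (fun y => b1 * ((y.1 - x.1) * rotation k l y))
      \+ (fun y => b2 * ((y.2 - x.2) * rotation k l y))
      \+ (fun y => p6 / 2 * ((y.1 - x.1) * ((y.1 - x.1) * rotation k l y)))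
      \+ (fun y => p7 * ((y.1 - x.1) * ((y.2 - x.2) * rotation k l y)))
      \+ (fun y => p8 / 2 * ((y.2 - x.2) * ((y.2 - x.2) * rotation k l y))))
      = (fun y => 0 * rotation k l y).
    apply/funext => y /=; rewrite mul0r; apply: etrans (g_eq k l y).
    rewrite /magnetic_field /b1 /b2.
    congr (_ + _).
    move: (rotation k l y) (x.1) (x.2) (y.1) (y.2) => r x1 x2 y1 y2.
    by field.
  have s1 (f : R * R -> R) : smooth f -> smooth (fun y : R * R => (y.1 - x.1) * f y).
    by move=> sf; apply: (@smoothM _ _ (fun y : R * R => y.1 - x.1)) => //; exact: smooth_shift_fst.
  have s2 (f : R * R -> R) : smooth f -> smooth (fun y : R * R => (y.2 - x.2) * f y).
    by move=> sf; apply: (@smoothM _ _ (fun y : R * R => y.2 - x.2)) => //; exact: smooth_shift_snd.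
  have sr := rot_smooth k l.
  have sx : smooth ('D_(1, 0) (g k.-1 l)) by exact: smooth_derive.
  have sy : smooth ('D_(0, 1) (g k l.-1)) by exact: smooth_derive.
  move/(congr1 (fun f => plane_jet f x a b)): pde.
  rewrite !plane_jetD; try by repeat first
    [exact: sr|exact: sx|exact: sy|apply: smoothD|apply: smoothZ|apply: (s1)|apply: (s2)].
  rewrite !plane_jetZ; try by repeat first [exact: sr|exact: sx|exact: sy|apply: (s1)|apply: (s2)].
  rewrite mul0r !plane_jet_mul1 ?plane_jet_mul2 //; try by repeat first
    [exact: sr|exact: sx|exact: sy|apply: (s1)|apply: (s2)].
  rewrite plane_jet_dx // plane_jet_dy ?plane_jet_mul2 //.
  move/(congr1 (fun r => r%:C%C)); rewrite rmorph0 => <-.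
  rewrite !(rmorphD, rmorphM) !rmorph_nat /= -!jet_rotE.
  rewrite /jet_field !jetDE -[(_ *: _) _ _ _ _]/(_ * _).
  by rewrite /jet_v1 /jet_v2 /jet_d1 /jet_d2 /jet_x1 /jet_x2 !mul1r.
have im2 : 'i%C * 'i%C = -1 :> R[i] by rewrite -expr2 sqr_i.
have disc : p7%:C%C ^+ 2 != 4 * (p6 / 2)%:C%C * (p8 / 2)%:C%C :> R[i].
  rewrite -rmorphXn -(rmorph_nat (real_complex R)) -!rmorphM /= (inj_eq (fmorph_inj _)).
  by rewrite (_ : 4 * (p6 / 2) * (p8 / 2) = p6 * p8) //; field.
(* Its imaginary part is [- p7]. *)
have lead : (p6 / 2)%:C%C - (p8 / 2)%:C%C - 'i%C * p7%:C%C != 0 :> R[i].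
  rewrite eq_complex /= negb_and; apply/orP; right.
  by rewrite !(mul0r, mul1r, mulr0, oppr0, addr0, add0r) oppr_eq0.
have u_top a b k l : (N <= k + l)%N -> u a b k l = 0.
  move=> Nkl; rewrite /u (_ : g k l = fun y => 0 * g k l y).
    by rewrite plane_jetZ // mul0r rmorph0.
  by apply/funext => y; rewrite g_top // mulr0.
have inj (r : R) : r%:C%C = 0 :> R[i] -> r = 0 by move/eqP; rewrite fmorph_eq0 => /eqP.
have rigid := @jet_rigid R[i] 'i%C im2 _ _ _ _ _ _ N u disc lead u_top u_eq.
split.
- by have [/inj h _ _] := rigid 0%N 0%N i j.
- by have [_ /inj h _] := rigid 0%N 0%N i j.
- by have [_ _] := rigid 0%N 0%N i j; rewrite jet_rotE => /inj.
Qed.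
End PlaneIntegrals.

(** * Reduction to the plane *)

Section PolynomialCoefficients.
Variables (R : realType) (V : normedModType R).
Implicit Types Q : V -> {poly {poly R}}.

(** The outer variable stands for v_1 and the inner one for v_2; the bound on the total degree is
    uniform in the base point. *)
Definition smooth_coefs Q : Prop :=
  (forall i j, smooth (fun x => (Q x)`_i`_j)) /\
  exists n, forall i j x, (n <= i + j)%N -> (Q x)`_i`_j = 0.

Lemma smooth_coefsD Q1 Q2 : smooth_coefs Q1 -> smooth_coefs Q2 ->
  smooth_coefs (fun x => Q1 x + Q2 x).
Proof.
move=> [s1 [n1 b1]] [s2 [n2 b2]]; split=> [i j|].
  rewrite (_ : (fun x => _) = (fun x => (Q1 x)`_i`_j) \+ (fun x => (Q2 x)`_i`_j)).
    exact: smoothD.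
  by apply/funext => x; rewrite !coefD.
by exists (n1 + n2)%N => i j x nij; rewrite !coefD b1 ?b2 ?addr0 //; lia.
Qed.

Lemma smooth_coefsM Q1 Q2 : smooth_coefs Q1 -> smooth_coefs Q2 ->
  smooth_coefs (fun x => Q1 x * Q2 x).
Proof.
move=> [s1 [n1 b1]] [s2 [n2 b2]].
have coefMM i j x : (Q1 x * Q2 x)`_i`_j = \sum_(k < i.+1) \sum_(l < j.+1)
    (Q1 x)`_k`_l * (Q2 x)`_(i - k)`_(j - l).
  by rewrite coefM coef_sum; apply: eq_bigr => k _; rewrite coefM.
split=> [i j|].
  rewrite (_ : (fun x => _) = fun x => \sum_(k < i.+1) \sum_(l < j.+1)
    (Q1 x)`_k`_l * (Q2 x)`_(i - k)`_(j - l)); last by apply/funext => x.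
  apply: smooth_sum => k; apply: smooth_sum => l.
  by apply: (@smoothM _ _ (fun x => (Q1 x)`_k`_l)).
exists (n1 + n2)%N => i j x nij; rewrite coefMM.
apply: big1 => k _; apply: big1 => l _.
have [kl|kl] := leqP n1 (k + l); first by rewrite b1 // mul0r.
by rewrite b2 ?mulr0 //; have := ltn_ord k; have := ltn_ord l; lia.
Qed.

Lemma smooth_coefs_const (f : V -> R) : smooth f -> smooth_coefs (fun x => (f x)%:P%:P).
Proof.
move=> sf; split=> [i j|].
  rewrite (_ : (fun x => _) = (fun x => ((i == 0%N) && (j == 0%N))%:R * f x)).
    by apply: (@smoothM _ _ (fun=> _)) => //; exact: smooth_cst.
  apply/funext => x; rewrite coefC; case: eqP => _ /=; last by rewrite coef0 mul0r.
  by rewrite coefC; case: eqP => _; rewrite ?mul1r ?mul0r.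
exists 1%N => i j x; rewrite coefC; case: eqP => [->|_ _]; last by rewrite coef0.
by rewrite coefC add0n; case: j.
Qed.

Lemma smooth_coefs_cst (p : {poly {poly R}}) : smooth_coefs (fun=> p).
Proof.
split=> [i j|]; first exact: smooth_cst.
exists (size p + \max_(i < size p) size (p`_i)%R)%N => i j _ nij.
have [ip|ip] := leqP (size p) i; first by rewrite (nth_default _ ip) coef0.
apply: nth_default.
have := leq_bigmax (F := fun i : 'I_(size p) => size p`_i) (Ordinal ip).
by move: nij ip; rewrite /=; set m := \max_(_ < _) _; lia.
Qed.

Lemma smooth_coefsX Q n : smooth_coefs Q -> smooth_coefs (fun x => Q x ^+ n).
Proof.
move=> sQ; elim: n => [|n IHn]; first exact: smooth_coefs_cst.
rewrite (_ : (fun x => _) = (fun x => Q x * Q x ^+ n)); first exact: smooth_coefsM.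
by apply/funext => x; rewrite exprS.
Qed.

Lemma smooth_coefs_sum (I : Type) (r : seq I) (P : pred I) (Q : I -> V -> {poly {poly R}}) :
  (forall i, P i -> smooth_coefs (Q i)) ->
  smooth_coefs (fun x => \sum_(i <- r | P i) Q i x).
Proof.
move=> sQ; elim: r => [|i r IHr].
  rewrite (_ : (fun x => _) = (fun=> 0)); first exact: smooth_coefs_cst.
  by apply/funext => x; rewrite big_nil.
rewrite (_ : (fun x => _) = if P i then (fun x => Q i x + \sum_(i <- r | P i) Q i x) else
  (fun x => \sum_(i <- r | P i) Q i x)).
  by case: ifP => // Pi; apply: smooth_coefsD => //; exact: sQ.
by apply/funext => x; rewrite big_cons; case: ifP.
Qed.

Lemma smooth_coefs_horner Q : smooth_coefs Q -> exists m, forall n, (m <= n)%N ->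
  (forall i j x, (m <= i + j)%N -> (Q x)`_i`_j = 0) /\
  forall x v1 v2, (Q x).[v1%:P].[v2] =
    \sum_(i < n) (\sum_(j < n) (Q x)`_i`_j * v2 ^+ j) * v1 ^+ i.
Proof.
move=> [_ [m b]]; exists m => n mn; split=> // x v1 v2.
have sQ : (size (Q x) <= n)%N.
  by apply/leq_sizeP => i ni; apply/polyP => j; rewrite coef0 b //; lia.
rewrite (horner_coef_wide _ sQ) horner_sum; apply: eq_bigr => i _.
rewrite -rmorphXn hornerM hornerC; congr (_ * _).
by apply: horner_coef_wide; apply/leq_sizeP => j nj; rewrite b //; lia.
Qed.

End PolynomialCoefficients.

(** * Derivatives along coordinate lines *)

Section LineDerivatives.
Variable R : realType.

Lemma derive_of_line (V : normedModType R) (f : V -> R) (g : R -> R) (z v : V) (dg : R) :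
  (forall h : R, f (h *: v + z) = g h) -> is_derive (0 : R) (1 : R) g dg -> 'D_v f z = dg.
Proof.
move=> fg dgE; rewrite -(@derive_val _ _ _ _ _ _ _ dgE) /derive.
rewrite (_ : (fun h : R => _) = fun h : R => h^-1 *: ((g \o shift 0) (h *: (1 : R)) - g 0)) //.
apply/funext => h /=; rewrite -(fg 0) scale0r add0r addr0.
by rewrite -fg [h *: 1]mulr1.
Qed.

Lemma is_derive_sumf n (F : 'I_n -> R -> R) (dF : 'I_n -> R) (t v : R) :
  (forall i, is_derive t v (F i) (dF i)) ->
  is_derive t v (fun h => \sum_(i < n) F i h) (\sum_(i < n) dF i).
Proof.
move=> dFi; rewrite (_ : (fun h => _) = \sum_(i < n) F i); first exact: is_derive_sum.
by apply/funext => h; rewrite fct_sumE.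
Qed.

Lemma is_derive_mulf (f g : R -> R) (t df dg : R) :
  is_derive t (1 : R) f df -> is_derive t (1 : R) g dg ->
  is_derive t (1 : R) (fun h => f h * g h) (df * g t + f t * dg).
Proof.
move=> Df Dg; apply: (@is_derive_eq _ _ _ (f * g)).
by rewrite addrC; congr (_ + _); exact: mulrC.
Qed.

Lemma is_derive_expf (f : R -> R) n (t df : R) : is_derive t (1 : R) f df ->
  is_derive t (1 : R) (fun h => f h ^+ n) (df * (n%:R * f t ^+ n.-1)).
Proof.
move=> Df; rewrite (_ : (fun h => _) = f ^+ n); last by apply/funext => h; rewrite exprfctE.
by apply: (is_derive_eq (is_deriveX _ Df)); rewrite [_ *: _]mulrC.
Qed.

(** Along each coordinate line [omega1] and [omega2] are polynomials of degree at most 3. *)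
Lemma is_derive_cubic (k0 k1 k2 k3 : R) :
  is_derive (0 : R) (1 : R) (fun h : R => k0 + k1 * h + k2 * h ^+ 2 + k3 * h ^+ 3) k1.
Proof.
have did : is_derive (0 : R) (1 : R) (fun h : R => h) 1 by exact: is_derive_id.
have dX n := is_derive_expf n did.
have dcst (k : R) : is_derive (0 : R) (1 : R) (fun _ : R => k) 0 by exact: is_derive_cst.
have dZ k f df (Df : is_derive (0 : R) (1 : R) f df) := is_derive_mulf (dcst k) Df.
pose F (i : 'I_4) (h : R) : R := nth 0 [:: k0; k1; k2; k3] i * h ^+ i.
rewrite (_ : (fun h => _) = fun h => \sum_(i < 4) F i h); last first.
  by apply/funext => h; rewrite /F !big_ord_recl big_ord0 /= expr0 expr1 mulr1; ring.
apply: is_derive_eq; first by apply: is_derive_sumf => i; apply: dZ; exact: dX.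
rewrite !big_ord_recl big_ord0 /= !expr0 /bump !leq0n /= !add0n !add1n; ring.
Qed.

Variables (n : nat) (b : nat -> nat -> R * R -> R) (x u : R * R) (W1 W2 : R -> R) (w1 w2 : R).
Hypothesis b_smooth : forall i j, smooth (b i j).
Hypothesis dW1 : is_derive (0 : R) (1 : R) W1 w1.
Hypothesis dW2 : is_derive (0 : R) (1 : R) W2 w2.

Definition form_value (c : nat -> nat -> R) (v1 v2 : R) : R :=
  \sum_(i < n) (\sum_(j < n) c i j * v2 ^+ j) * v1 ^+ i.
Definition form_d1 (c : nat -> nat -> R) (v1 v2 : R) : R :=
  \sum_(i < n) (\sum_(j < n) c i j * v2 ^+ j) * (i%:R * v1 ^+ i.-1).
Definition form_d2 (c : nat -> nat -> R) (v1 v2 : R) : R :=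
  \sum_(i < n) (\sum_(j < n) c i j * (j%:R * v2 ^+ j.-1)) * v1 ^+ i.

(** Chain rule with three contributions: the coefficients move with the base point, and [W1], [W2]
    are the velocities along the line. *)
Lemma is_derive_form :
  is_derive (0 : R) (1 : R)
    (fun h : R => form_value (fun i j => b i j (x + h *: u)) (W1 h) (W2 h))
    (form_value (fun i j => 'D_u (b i j) x) (W1 0) (W2 0)
     + w1 * form_d1 (fun i j => b i j x) (W1 0) (W2 0)
     + w2 * form_d2 (fun i j => b i j x) (W1 0) (W2 0)).
Proof.
have db i j : is_derive (0 : R) (1 : R) (fun h : R => b i j (x + h *: u)) ('D_u (b i j) x).
  have -> : 'D_u (b i j) x = 'D_u (b i j) (x + (0 : R) *: u) by rewrite scale0r addr0.
  by apply: is_derive_line; exact: smooth_derivable.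
have dcol i := is_derive_sumf (fun j : 'I_n => is_derive_mulf (db i j) (is_derive_expf j dW2)).
apply: (is_derive_eq (is_derive_sumf
  (fun i : 'I_n => is_derive_mulf (dcol i) (is_derive_expf i dW1)))).
rewrite /form_value /form_d1 /form_d2 !mulr_sumr -!big_split /=; apply: eq_bigr => i _.
rewrite scale0r addr0 big_split /= [X in (_ + X) * _](_ : _ =
  w2 * \sum_(j < n) b i j x * (j%:R * W2 0 ^+ j.-1)); last first.
  by rewrite mulr_sumr; apply: eq_bigr => j _; ring.
by ring.
Qed.

End LineDerivatives.

(** * Operations on velocity polynomials, read on coefficients *)

Section Reindexing.
Variables (R : realType) (n : nat).
Implicit Types c : nat -> nat -> R.

(** The vanishing top coefficient keeps the product within the same range of exponents. *)
Lemma mul_sum_pow (c : nat -> R) v : c n = 0 ->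
  v * (\sum_(i < n.+1) c i * v ^+ i) =
  \sum_(i < n.+1) (if (i : nat) is i'.+1 then c i' else 0) * v ^+ i.
Proof.
move=> cn; rewrite big_ord_recr /= cn mul0r addr0 big_ord_recl mul0r add0r mulr_sumr.
by apply: eq_bigr => i _; rewrite /= /bump leq0n add1n exprS; ring.
Qed.

Lemma deriv_sum_pow (c : nat -> R) v : c n.+1 = 0 ->
  \sum_(i < n.+1) c i * (i%:R * v ^+ i.-1) = \sum_(i < n.+1) i.+1%:R * c i.+1 * v ^+ i.
Proof.
move=> cn; rewrite big_ord_recl mul0r mulr0 add0r [RHS]big_ord_recr /= cn mulr0 mul0r addr0.
by apply: eq_bigr => i _; rewrite /= /bump leq0n add1n /=; ring.
Qed.

Lemma mul_form_value1 c v1 v2 : (forall j, c n j = 0) ->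
  v1 * form_value n.+1 c v1 v2 =
  form_value n.+1 (fun i j => if i is i'.+1 then c i' j else 0) v1 v2.
Proof.
move=> cn; rewrite /form_value (mul_sum_pow (c := fun i => \sum_(j < n.+1) c i j * v2 ^+ j)).
  apply: eq_bigr => -[[|i] ?] _ //=; congr (_ * _).
  by rewrite big1 // => j _; rewrite mul0r.
by rewrite big1 // => j _; rewrite cn mul0r.
Qed.

Lemma mul_form_value2 c v1 v2 : (forall i, c i n = 0) ->
  v2 * form_value n.+1 c v1 v2 =
  form_value n.+1 (fun i j => if j is j'.+1 then c i j' else 0) v1 v2.
Proof.
move=> cn; rewrite /form_value mulr_sumr; apply: eq_bigr => i _; rewrite mulrA.
by rewrite (mul_sum_pow (c := c i)).
Qed.

Lemma form_d1E c v1 v2 : (forall j, c n.+1 j = 0) ->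
  form_d1 n.+1 c v1 v2 = form_value n.+1 (fun i j => i.+1%:R * c i.+1 j) v1 v2.
Proof.
move=> cn; rewrite /form_d1 (deriv_sum_pow (c := fun i => \sum_(j < n.+1) c i j * v2 ^+ j)).
  apply: eq_bigr => i _; congr (_ * _); rewrite mulr_sumr.
  by apply: eq_bigr => j _; rewrite mulrA.
by rewrite big1 // => j _; rewrite cn mul0r.
Qed.

Lemma form_d2E c v1 v2 : (forall i, c i n.+1 = 0) ->
  form_d2 n.+1 c v1 v2 = form_value n.+1 (fun i j => j.+1%:R * c i j.+1) v1 v2.
Proof.
move=> cn; rewrite /form_d2; apply: eq_bigr => i _; congr (_ * _).
exact: (deriv_sum_pow (c := c i)).
Qed.

Lemma form_valueD c1 c2 v1 v2 m :
  form_value m c1 v1 v2 + form_value m c2 v1 v2 = form_value m (fun i j => c1 i j + c2 i j) v1 v2.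
Proof.
rewrite /form_value -big_split; apply: eq_bigr => i _ /=; rewrite -mulrDl -big_split /=.
by congr (_ * _); apply: eq_bigr => j _; rewrite mulrDl.
Qed.

Lemma form_valueZ c k v1 v2 m :
  k * form_value m c v1 v2 = form_value m (fun i j => k * c i j) v1 v2.
Proof.
rewrite /form_value mulr_sumr; apply: eq_bigr => i _ /=; rewrite mulrA mulr_sumr.
by congr (_ * _); apply: eq_bigr => j _; rewrite mulrA.
Qed.

Definition rotation_coef c (i j : nat) : R :=
  (if i is i'.+1 then j.+1%:R * c i' j.+1 else 0)
  - (if j is j'.+1 then i.+1%:R * c i.+1 j' else 0).

Lemma form_rotation c v1 v2 : (forall i j, (n <= i + j)%N -> c i j = 0) ->
  v1 * form_d2 n.+1 c v1 v2 - v2 * form_d1 n.+1 c v1 v2 =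
  form_value n.+1 (rotation_coef c) v1 v2.
Proof.
move=> cn; rewrite form_d1E ?form_d2E; try by move=> *; apply: cn; lia.
rewrite mul_form_value1 ?mul_form_value2; try by move=> *; rewrite cn ?mulr0 //; lia.
by rewrite -[- _]mulN1r form_valueZ form_valueD; congr form_value;
  apply/funext => i; apply/funext => j; rewrite mulN1r.
Qed.

Lemma sum_pow_eq0 (c : nat -> R) m : (forall v, \sum_(i < m) c i * v ^+ i = 0) ->
  forall i, (i < m)%N -> c i = 0.
Proof.
move=> c0; pose p := \poly_(i < m) c i.
suff p0 : p = 0 by move=> i im; have := coef_poly m c i; rewrite -/p p0 coef0 im.
apply/eqP; apply: contraT => pn0.
(* The points 0, ..., [size p - 1] are more roots than a non-zero [p] can have. *)
pose s := [seq i%:R : R | i <- iota 0 (size p)].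
have : (size s < size p)%N.
  apply: max_poly_roots => //.
    apply/allP => v _; rewrite rootE -[_ == _]/(p.[v] == 0) /p horner_poly.
    by rewrite c0.
  by rewrite map_inj_uniq ?iota_uniq // => i j /eqP; rewrite eqr_nat => /eqP.
by rewrite size_map size_iota ltnn.
Qed.

Lemma form_value_eq0 c m : (forall v1 v2, form_value m c v1 v2 = 0) ->
  forall i j, (i < m)%N -> (j < m)%N -> c i j = 0.
Proof.
move=> c0 i j im jm; apply: (@sum_pow_eq0 (c i) m) => // v2.
by apply: (@sum_pow_eq0 (fun i => \sum_(j < m) c i j * v2 ^+ j) m) => // v1; exact: c0.
Qed.
End Reindexing.

(** * Velocities in place of the momenta p_1 and p_2 *)

Section Phase.
Variable R : realType.
Implicit Types (z y : cotangent R 8) (x : R * R).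

Definition base z : R * R := ('x_1 z, 'x_2 z).
Definition same_charge z y : Prop :=
  forall i : 'I_8, i != ord8 1 -> i != ord8 2 -> momentum i z = momentum i y.

(** With [potential2], the vector potential of the planar field for the charges p_3, ..., p_8 of
    [z]. *)
Definition potential1 z x : R :=
  - 2^-1 * x.2 * 'p_3 z - 2^-1 * (x.1 ^+ 2 + x.2 ^+ 2) * 'p_5 z
  - 4^-1 * x.1 * x.2 ^+ 2 * 'p_7 z - 6^-1 * x.2 ^+ 3 * 'p_8 z.

Definition potential2 z x : R :=
  2^-1 * x.1 * 'p_3 z + 2^-1 * (x.1 ^+ 2 + x.2 ^+ 2) * 'p_4 z
  + 6^-1 * x.1 ^+ 3 * 'p_6 z + 4^-1 * x.1 ^+ 2 * x.2 * 'p_7 z.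

Lemma omega1E z y : same_charge z y -> omega1 z = 'p_1 z + potential1 y (base z).
Proof.
by move=> zy; rewrite /omega1 /potential1 -!zy //=; ring.
Qed.

Lemma omega2E z y : same_charge z y -> omega2 z = 'p_2 z + potential2 y (base z).
Proof.
by move=> zy; rewrite /omega2 /potential2 -!zy //=; ring.
Qed.

Lemma smooth_potential1 y : smooth (potential1 y).
Proof.
have s1 := @smooth_fst R; have s2 := @smooth_snd R.
have sM (f g : R * R -> R) : smooth f -> smooth g -> smooth (fun x => f x * g x) by exact: smoothM.
have sD (f g : R * R -> R) : smooth f -> smooth g -> smooth (fun x => f x + g x) by exact: smoothD.
have sc (c : R) : smooth (fun _ : R * R => c) by exact: smooth_cst.
rewrite (_ : potential1 y = fun x => (- 2^-1 * 'p_3 y) * x.2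
  + (- 2^-1 * 'p_5 y) * (x.1 * x.1 + x.2 * x.2) + (- 4^-1 * 'p_7 y) * (x.1 * (x.2 * x.2))
  + (- 6^-1 * 'p_8 y) * (x.2 * (x.2 * x.2))); last first.
  by apply/funext => x; rewrite /potential1; ring.
by repeat first [exact: sc|exact: s1|exact: s2|apply: (sD)|apply: (sM)].
Qed.

Lemma smooth_potential2 y : smooth (potential2 y).
Proof.
have s1 := @smooth_fst R; have s2 := @smooth_snd R.
have sM (f g : R * R -> R) : smooth f -> smooth g -> smooth (fun x => f x * g x) by exact: smoothM.
have sD (f g : R * R -> R) : smooth f -> smooth g -> smooth (fun x => f x + g x) by exact: smoothD.
have sc (c : R) : smooth (fun _ : R * R => c) by exact: smooth_cst.
rewrite (_ : potential2 y = fun x => (2^-1 * 'p_3 y) * x.1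
  + (2^-1 * 'p_4 y) * (x.1 * x.1 + x.2 * x.2) + (6^-1 * 'p_6 y) * (x.1 * (x.1 * x.1))
  + (4^-1 * 'p_7 y) * (x.1 * (x.1 * x.2))); last first.
  by apply/funext => x; rewrite /potential2; ring.
by repeat first [exact: sc|exact: s1|exact: s2|apply: (sD)|apply: (sM)].
Qed.

Variables (d : nat) (a : multi_index d -> R * R -> R).
Hypothesis a_smooth : forall tau, mdegree tau = d -> smooth (a tau).

(** The form after substituting velocity minus potential for p_1 and p_2, with the charges of [y] as
    constants. *)
Definition form_poly y x : {poly {poly R}} :=
  \sum_(tau : multi_index d | mdegree tau == d)
    (a tau x)%:P%:P * (\prod_(i < 8 | (i != ord8 1) && (i != ord8 2)) momentum i y ^+ tau i)%:P%:P
    * ('X - (potential1 y x)%:P%:P) ^+ tau (ord8 1)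
    * ('X%:P - (potential2 y x)%:P%:P) ^+ tau (ord8 2).

Lemma smooth_form_poly y : smooth_coefs (form_poly y).
Proof.
have sN (f : R * R -> R) : smooth f -> smooth (fun x => - f x).
  move=> sf; rewrite (_ : (fun x => _) = fun x => -1 * f x); first exact: smoothZ.
  by apply/funext => x; rewrite mulN1r.
apply: smooth_coefs_sum => tau /eqP dtau.
apply: (@smooth_coefsM _ _ (fun x => _ * _) (fun x => _ ^+ _)); last first.
  apply: smooth_coefsX; rewrite (_ : (fun x => _) = fun x => 'X%:P + (- potential2 y x)%:P%:P).
    apply: smooth_coefsD; first exact: smooth_coefs_cst.
    by apply: smooth_coefs_const; apply: sN; exact: smooth_potential2.
  by apply/funext => x; rewrite !polyCN.
apply: (@smooth_coefsM _ _ (fun x => _ * _) (fun x => _ ^+ _)); last first.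
  apply: smooth_coefsX; rewrite (_ : (fun x => _) = fun x => 'X + (- potential1 y x)%:P%:P).
    apply: smooth_coefsD; first exact: smooth_coefs_cst.
    by apply: smooth_coefs_const; apply: sN; exact: smooth_potential1.
  by apply/funext => x; rewrite !polyCN.
apply: smooth_coefsM; last exact: smooth_coefs_cst.
by apply: smooth_coefs_const; exact: a_smooth.
Qed.

Lemma form_polyE z y : same_charge z y ->
  momentum_form a z = (form_poly y (base z)).[(omega1 z)%:P].[omega2 z].
Proof.
move=> zy; rewrite /form_poly !horner_sum; apply: eq_bigr => tau _.
rewrite !(hornerM, horner_exp, hornerD, hornerN, hornerX, hornerC).
rewrite (omega1E zy) (omega2E zy) !addrK.
rewrite (bigD1 (ord8 1)) // (bigD1 (ord8 2)) //=.
rewrite [in RHS](eq_bigr (fun i => momentum i z ^+ tau i)); last first.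
  by move=> i /andP[i1 i2]; rewrite zy.
by rewrite -/(base z); ring.
Qed.

(** The coefficients vanish from total degree [n] on, yet the sum includes exponent [n]: the spare
    place absorbs the multiplication by a velocity in the Poisson bracket. *)
Lemma momentum_form_rep y : exists n (b : nat -> nat -> R * R -> R), [/\
  forall i j, smooth (b i j),
  forall i j x, (n <= i + j)%N -> b i j x = 0 &
  forall z, same_charge z y -> momentum_form a z =
    form_value n.+1 (fun i j => b i j (base z)) (omega1 z) (omega2 z)].
Proof.
have sQ := smooth_form_poly y; have [m mP] := smooth_coefs_horner sQ.
have [b0 bE] := mP m.+1 (leqnSn m).
exists m, (fun i j x => (form_poly y x)`_i`_j); split=> //; first by case: sQ.
by move=> z zy; rewrite (form_polyE zy) bE.
Qed.
End Phase.

(** * Partial derivatives and the Poisson bracket *)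

Section Partials.
Variable R : realType.
Implicit Types (z y : cotangent R 8) (x : R * R) (h : R).

Lemma position_line_x (i j : 'I_8) h z :
  position i (h *: delta_mx 0 (lshift 8 j) + z) = h * (i == j)%:R + position i z.
Proof. by rewrite /position !mxE eqxx /= eq_lshift. Qed.

Lemma position_line_p (i j : 'I_8) h z :
  position i (h *: delta_mx 0 (rshift 8 j) + z) = position i z.
Proof. by rewrite /position !mxE eqxx /= eq_lrshift mulr0 add0r. Qed.

Lemma momentum_line_x (i j : 'I_8) h z :
  momentum i (h *: delta_mx 0 (lshift 8 j) + z) = momentum i z.
Proof. by rewrite /momentum !mxE eqxx /= eq_rlshift mulr0 add0r. Qed.

Lemma momentum_line_p (i j : 'I_8) h z :
  momentum i (h *: delta_mx 0 (rshift 8 j) + z) = h * (i == j)%:R + momentum i z.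
Proof. by rewrite /momentum !mxE eqxx /= eq_rshift. Qed.

(** In the names of the slopes the first digit is the direction of differentiation, the second the
    velocity differentiated. *)
Definition slope11 z : R := - 'x_1 z * 'p_5 z - 4^-1 * 'x_2 z ^+ 2 * 'p_7 z.
Definition slope12 z : R := 2^-1 * 'p_3 z + 'x_1 z * 'p_4 z
  + 2^-1 * 'x_1 z ^+ 2 * 'p_6 z + 2^-1 * 'x_1 z * 'x_2 z * 'p_7 z.
Definition slope21 z : R := - 2^-1 * 'p_3 z - 'x_2 z * 'p_5 z
  - 2^-1 * 'x_1 z * 'x_2 z * 'p_7 z - 2^-1 * 'x_2 z ^+ 2 * 'p_8 z.
Definition slope22 z : R := 'x_2 z * 'p_4 z + 4^-1 * 'x_1 z ^+ 2 * 'p_7 z.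

Definition lineE := (position_line_x, position_line_p, momentum_line_x, momentum_line_p).

Section Representation.
Variables (F : cotangent R 8 -> R) (n : nat) (b : nat -> nat -> R * R -> R) (z : cotangent R 8).
Hypothesis b_smooth : forall i j, smooth (b i j).
Hypothesis F_rep : forall y, same_charge y z ->
  F y = form_value n.+1 (fun i j => b i j (base y)) (omega1 y) (omega2 y).

Lemma partial_line (e : 'I_(8 + 8)) (u : R * R) (c1 c2 k1 k2 l1 l2 : R) :
  (forall h, same_charge (h *: delta_mx 0 e + z) z) ->
  (forall h, base (h *: delta_mx 0 e + z) = base z + h *: u) ->
  (forall h, omega1 (h *: delta_mx 0 e + z) = omega1 z + c1 * h + k1 * h ^+ 2 + l1 * h ^+ 3) ->
  (forall h, omega2 (h *: delta_mx 0 e + z) = omega2 z + c2 * h + k2 * h ^+ 2 + l2 * h ^+ 3) ->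
  partial e F z = form_value n.+1 (fun i j => 'D_u (b i j) (base z)) (omega1 z) (omega2 z)
    + c1 * form_d1 n.+1 (fun i j => b i j (base z)) (omega1 z) (omega2 z)
    + c2 * form_d2 n.+1 (fun i j => b i j (base z)) (omega1 z) (omega2 z)
  /\ partial e (@H2358 R) z = omega1 z * c1 + omega2 z * c2.
Proof.
move=> ch bs o1 o2.
have D1 := is_derive_cubic (omega1 z) c1 k1 l1; have D2 := is_derive_cubic (omega2 z) c2 k2 l2.
have at0 (k c1' k1' l1' : R) : k + c1' * 0 + k1' * 0 ^+ 2 + l1' * 0 ^+ 3 = k.
  by rewrite !expr0n /= !mulr0 !addr0.
have DF := is_derive_form n.+1 (base z) u b_smooth D1 D2.
have DD := is_derive_mulf (is_derive_cst (2^-1 : R) (0 : R) (1 : R))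
  (is_deriveD (is_derive_expf 2 D1) (is_derive_expf 2 D2)).
split.
  apply: etrans (derive_of_line _ DF) _; last by rewrite !at0.
  by move=> h; rewrite F_rep // bs o1 o2.
apply: etrans (derive_of_line _ DD) _; last by rewrite /= fctE !at0 /cst; field.
by move=> h; rewrite /H2358 o1 o2.
Qed.

Definition d1_value := form_d1 n.+1 (fun i j => b i j (base z)) (omega1 z) (omega2 z).
Definition d2_value := form_d2 n.+1 (fun i j => b i j (base z)) (omega1 z) (omega2 z).
Definition dx_value (u : R * R) :=
  form_value n.+1 (fun i j => 'D_u (b i j) (base z)) (omega1 z) (omega2 z).

Ltac omega_line :=
  move=> h; rewrite /omega1 /omega2 !lineE /slope11 /slope12 /slope21 /slope22 /=; field.
Ltac base_line := move=> h; rewrite /base !lineE /=;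
  congr pair; rewrite /= -[RHS]/(_ + _ * _); ring.

Lemma partial_x1 : partial (lshift 8 (ord8 1)) F z =
    dx_value (1, 0) + slope11 z * d1_value + slope12 z * d2_value
  /\ partial (lshift 8 (ord8 1)) (@H2358 R) z = omega1 z * slope11 z + omega2 z * slope12 z.
Proof.
apply: (@partial_line _ (1, 0) (slope11 z) (slope12 z) (- 2^-1 * 'p_5 z)
  (2^-1 * 'p_4 z + 2^-1 * 'x_1 z * 'p_6 z + 4^-1 * 'x_2 z * 'p_7 z) 0 (6^-1 * 'p_6 z)).
- by move=> h i _ _; rewrite lineE.
- by base_line.
- by omega_line.
- by omega_line.
Qed.

Lemma partial_x2 : partial (lshift 8 (ord8 2)) F z =
    dx_value (0, 1) + slope21 z * d1_value + slope22 z * d2_value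
  /\ partial (lshift 8 (ord8 2)) (@H2358 R) z = omega1 z * slope21 z + omega2 z * slope22 z.
Proof.
apply: (@partial_line _ (0, 1) (slope21 z) (slope22 z)
  (- 2^-1 * 'p_5 z - 4^-1 * 'x_1 z * 'p_7 z - 2^-1 * 'x_2 z * 'p_8 z) (2^-1 * 'p_4 z)
  (- 6^-1 * 'p_8 z) 0).
- by move=> h i _ _; rewrite lineE.
- by base_line.
- by omega_line.
- by omega_line.
Qed.

Lemma partial_p1 : partial (rshift 8 (ord8 1)) F z = d1_value
  /\ partial (rshift 8 (ord8 1)) (@H2358 R) z = omega1 z.
Proof.
have [| | | |-> ->] := @partial_line (rshift 8 (ord8 1)) 0 1 0 0 0 0 0.
- by move=> h i i1 i2; rewrite lineE (negPf i1) mulr0 add0r.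
- by move=> h; rewrite /base !lineE scaler0 addr0.
- by omega_line.
- by omega_line.
split; last by ring.
rewrite [form_value _ _ _ _](_ : _ = 0) ?add0r ?mul1r ?mul0r ?addr0 //.
by apply: big1 => i _; rewrite big1 ?mul0r // => j _; rewrite derive0 mul0r.
Qed.

Lemma partial_p2 : partial (rshift 8 (ord8 2)) F z = d2_value
  /\ partial (rshift 8 (ord8 2)) (@H2358 R) z = omega2 z.
Proof.
have [| | | |-> ->] := @partial_line (rshift 8 (ord8 2)) 0 0 1 0 0 0 0.
- by move=> h i i1 i2; rewrite lineE (negPf i2) mulr0 add0r.
- by move=> h; rewrite /base !lineE scaler0 addr0.
- by omega_line.
- by omega_line.
split; last by ring.
rewrite [form_value _ _ _ _](_ : _ = 0) ?add0r ?mul1r ?mul0r ?addr0 ?add0r //.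
by apply: big1 => i _; rewrite big1 ?mul0r // => j _; rewrite derive0 mul0r.
Qed.

Lemma partial_high_x (j : 'I_8) : j != ord8 1 -> j != ord8 2 ->
  partial (lshift 8 j) F z = 0 /\ partial (lshift 8 j) (@H2358 R) z = 0.
Proof.
move=> j1 j2.
have bs h : base (h *: delta_mx 0 (lshift 8 j) + z) = base z.
  by rewrite /base !lineE !(eq_sym _ j) (negPf j1) (negPf j2) !mulr0 !add0r.
have o1 h : omega1 (h *: delta_mx 0 (lshift 8 j) + z) = omega1 z.
  by have := bs h; rewrite /base /omega1 => -[-> ->]; rewrite !lineE.
have o2 h : omega2 (h *: delta_mx 0 (lshift 8 j) + z) = omega2 z.
  by have := bs h; rewrite /base /omega2 => -[-> ->]; rewrite !lineE.
split; apply: derive_of_line (is_derive_cst _ _ _) => h.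
  rewrite F_rep ?bs ?o1 ?o2; last by move=> i _ _; rewrite lineE.
  by [].
by rewrite /H2358 o1 o2.
Qed.

(** The slopes [slope11] and [slope22] cancel, and the mixed ones combine to the curl of the
    potential, which is the magnetic field. *)
Lemma poisson_rep : poisson (@H2358 R) F z = - (omega1 z * dx_value (1, 0)
  + omega2 z * dx_value (0, 1) + (slope12 z - slope21 z) *
    (omega1 z * d2_value - omega2 z * d1_value)).
Proof.
rewrite /poisson (bigD1 (ord8 1)) // (bigD1 (ord8 2)) //= big1 => [|j /andP[j1 j2]]; last first.
  by have [-> ->] := partial_high_x j1 j2; rewrite mul0r mulr0 subrr.
rewrite partial_x1.1 partial_x1.2 partial_x2.1 partial_x2.2 partial_p1.1 partial_p1.2.
by rewrite partial_p2.1 partial_p2.2; ring.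
Qed.
End Representation.
End Partials.

(** * Functional dependence of the integral on H and the charges *)

Section Dependence.
Variables (R : realType) (d : nat) (a : multi_index d -> R * R -> R).
Hypothesis a_smooth : forall tau, mdegree tau = d -> smooth (a tau).
Hypothesis a_integral : forall z, poisson (@H2358 R) (momentum_form a) z = 0.
Variable z : cotangent R 8.
Hypothesis p7_neq0 : 'p_7 z != 0.
Hypothesis p_disc : 'p_7 z ^+ 2 != 'p_6 z * 'p_8 z.

(** For fixed charges, base point and velocity are arbitrary: solve for p_1 and p_2. This turns the
    vanishing of the bracket into a polynomial identity in the velocity. *)
Lemma same_charge_point (x v : R * R) : exists y : cotangent R 8,
  [/\ same_charge y z, base y = x, omega1 y = v.1 & omega2 y = v.2].
Proof.
pose P (i : 'I_8) := if i == ord8 1 then v.1 - potential1 z x else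
  if i == ord8 2 then v.2 - potential2 z x else momentum i z.
pose y : cotangent R 8 := row_mx (\row_(i < 8) nth 0 [:: x.1; x.2] i) (\row_(i < 8) P i).
have yp i : momentum i y = P i by rewrite /momentum row_mxEr mxE.
have yx i : position i y = nth 0 [:: x.1; x.2] i by rewrite /position row_mxEl mxE.
have yz : same_charge y z by move=> i i1 i2; rewrite yp /P (negPf i1) (negPf i2).
have by_ : base y = x by rewrite /base !yx -surjective_pairing.
exists y; split=> //.
  by rewrite (omega1E yz) by_ yp /P /= subrK.
by rewrite (omega2E yz) by_ yp /P /= subrK.
Qed.

Lemma slopeB (y : cotangent R 8) : same_charge y z -> slope12 y - slope21 y =
  magnetic_field ('p_3 z) ('p_4 z) ('p_5 z) ('p_6 z) ('p_7 z) ('p_8 z) (base y).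
Proof.
by move=> yz; rewrite /slope12 /slope21 /magnetic_field -!yz //=; field.
Qed.

Lemma momentum_form_rigid : exists n b, [/\
  forall i j, smooth (b i j),
  forall y, same_charge y z -> momentum_form a y =
    form_value n.+1 (fun i j => b i j (base y)) (omega1 y) (omega2 y),
  dx_value n b z (1, 0) = 0, dx_value n b z (0, 1) = 0 &
  omega1 z * d2_value n b z = omega2 z * d1_value n b z].
Proof.
have [n [b [b_smooth b_top F_rep]]] := momentum_form_rep a_smooth z.
exists n, b.
pose mf := magnetic_field ('p_3 z) ('p_4 z) ('p_5 z) ('p_6 z) ('p_7 z) ('p_8 z).
have Db_top (u : R * R) i j x : (n <= i + j)%N -> 'D_u (b i j) x = 0.
  move=> nij; rewrite (_ : b i j = fun=> 0) ?derive_cst //.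
  by apply/funext => y; rewrite b_top.
(* [c x i j] is the coefficient of [v1^i v2^j] in minus the bracket. *)
pose c x i j := (if i is i'.+1 then 'D_(1, 0) (b i' j) x else 0)
  + (if j is j'.+1 then 'D_(0, 1) (b i j') x else 0)
  + mf x * rotation_coef (fun i j => b i j x) i j.
have c0 x i j : c x i j = 0.
  have [ij|] := boolP ((i < n.+1)%N && (j < n.+1)%N); last first.
    move=> ij; have nij : (n < i + j)%N by lia.
    rewrite /c /rotation_coef; case: i j ij nij => [|i] [|j] ij nij //;
      rewrite ?Db_top ?b_top ?(mulr0, subr0, addr0, oppr0, sub0r) //; lia.
  have /andP[ni nj] := ij.
  apply: (@form_value_eq0 _ _ n.+1) => // v1 v2.
  have [y [yz yx y1 y2]] := same_charge_point x (v1, v2).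
  have rep w : same_charge w y -> momentum_form a w =
      form_value n.+1 (fun i j => b i j (base w)) (omega1 w) (omega2 w).
    by move=> wy; apply: F_rep => k k1 k2; rewrite wy // yz.
  have := a_integral y; rewrite (poisson_rep b_smooth rep) slopeB //.
  rewrite /dx_value /d1_value /d2_value yx y1 y2 /= => /eqP; rewrite oppr_eq0 => /eqP.
  rewrite form_rotation; last by move=> *; exact: b_top.
  rewrite mul_form_value1 ?mul_form_value2 ?form_valueZ ?form_valueD //.
  - by move=> k; apply: Db_top; lia.
  - by move=> k; apply: Db_top; lia.
(* [g i j] is a velocity derivative at 0 instead of a coefficient, as [plane_rigid] expects. *)
pose g i j x := (i`! * j`!)%:R * b i j x.
have Dg (u : R * R) i j x : 'D_u (g i j) x = (i`! * j`!)%:R * 'D_u (b i j) x.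
  by apply: (@deriveZ _ _ R); exact: smooth_derivable.
have rotE i j x : rotation g i j x = (i`! * j`!)%:R * rotation_coef (fun i j => b i j x) i j.
  rewrite /rotation /rotation_coef /g; case: i j => [|i] [|j] /=;
    by rewrite ?mul0r ?sub0r ?subr0 ?oppr0 ?factS ?fact0 ?natrM; ring.
have g_eq i j x : i%:R * 'D_(1, 0) (g i.-1 j) x + j%:R * 'D_(0, 1) (g i j.-1) x
    + mf x * rotation g i j x = 0.
  transitivity ((i`! * j`!)%:R * c x i j); last by rewrite c0 mulr0.
  rewrite /c rotE !Dg; case: i j => [|i] [|j] /=;
    by rewrite ?mul0r ?factS ?fact0 ?natrM; ring.
have g_smooth i j : smooth (g i j) by exact: smoothZ.
have g_top i j x : (n <= i + j)%N -> g i j x = 0 by move=> nij; rewrite /g b_top // mulr0.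
have fact_neq0 i j : (i`! * j`!)%:R != 0 :> R by rewrite pnatr_eq0 -lt0n muln_gt0 !fact_gt0.
have rigid i j := plane_rigid p7_neq0 p_disc g_smooth g_top g_eq i j (base z).
have D0 u : (forall i j, 'D_u (g i j) (base z) = 0) -> dx_value n b z u = 0.
  move=> Du; apply: big1 => i _; rewrite big1 ?mul0r // => j _.
  have /eqP := Du i j; rewrite Dg mulf_eq0 (negPf (fact_neq0 _ _)) => /eqP ->.
  by rewrite mul0r.
split=> //.
- by apply: D0 => i j; have [] := rigid i j.
- by apply: D0 => i j; have [] := rigid i j.
apply/eqP; rewrite -subr_eq0 form_rotation; last by move=> *; exact: b_top.
apply/eqP/big1 => i _; rewrite big1 ?mul0r // => j _.
have [_ _] := rigid i j; rewrite rotE => /eqP; rewrite mulf_eq0 (negPf (fact_neq0 _ _)) => /eqP ->.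
by rewrite mul0r.
Qed.

(* At zero velocity H is critical in the directions x_i, p_1 and p_2, whence the pair
   (1, 0); elsewhere the rotation identity of [momentum_form_rigid] applies. *)
Lemma partials_dependent : exists2 lm : R * R, lm != 0 &
  forall e : 'I_(8 + 8), (forall i : 'I_8, i != ord8 1 -> i != ord8 2 -> e != rshift 8 i) ->
  lm.1 * partial e (@H2358 R) z + lm.2 * partial e (momentum_form a) z = 0.
Proof.
have [n [b [b_smooth F_rep Dx Dy rot]]] := momentum_form_rigid.
(* [l] and [s] are the radial velocity derivatives of the form and of H, so [(- l, s)] annihilates
   the radial direction; the rotational derivative is 0 for both. *)
pose l := omega1 z * d1_value n b z + omega2 z * d2_value n b z.
pose s := omega1 z ^+ 2 + omega2 z ^+ 2.
pose lm : R * R := if s == 0 then (1, 0) else (- l, s).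
exists lm; first by rewrite /lm; case: ifP => s0; rewrite xpair_eqE ?oner_eq0 // s0 andbF.
(* [c1] and [c2] are the derivatives of the two velocities in some direction; both differentials are
   linear in them because the coefficients contribute nothing. *)
have key (c1 c2 : R) : lm.1 * (omega1 z * c1 + omega2 z * c2) +
    lm.2 * (c1 * d1_value n b z + c2 * d2_value n b z) = 0.
  rewrite /lm; case: ifPn => [|_] /=.
    rewrite paddr_eq0 ?sqr_ge0 // !sqrf_eq0 => /andP[/eqP -> /eqP ->].
    by rewrite !(mul0r, mulr0, addr0).
  rewrite /l /s.
  have -> : - (omega1 z * d1_value n b z + omega2 z * d2_value n b z) *
   (omega1 z * c1 + omega2 z * c2) +
   (omega1 z ^+ 2 + omega2 z ^+ 2) * (c1 * d1_value n b z + c2 * d2_value n b z)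
   = (omega1 z * d2_value n b z - omega2 z * d1_value n b z) * (omega1 z * c2 - omega2 z * c1).
    by ring.
  by rewrite rot subrr mul0r.
move=> e; case: (split_ordP e) => i -> he.
  have [->|i1] := eqVneq i (ord8 1).
    have [-> ->] := partial_x1 b_smooth F_rep.
    by rewrite Dx add0r.
  have [->|i2] := eqVneq i (ord8 2).
    have [-> ->] := partial_x2 b_smooth F_rep.
    by rewrite Dy add0r.
  by have [-> ->] := partial_high_x F_rep i1 i2; rewrite !mulr0 addr0.
have [->|i1] := eqVneq i (ord8 1).
  have [-> ->] := partial_p1 b_smooth F_rep.
  by have := key 1 0; rewrite !(mulr1, mulr0, mul1r, mul0r, addr0).
have [->|i2] := eqVneq i (ord8 2).
  have [-> ->] := partial_p2 b_smooth F_rep.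
  by have := key 0 1; rewrite !(mulr1, mulr0, mul1r, mul0r, add0r).
by have := he i i1 i2; rewrite eqxx.
Qed.
End Dependence.

(** * Boxes have positive outer measure *)

Section Boxes.
Variable R : realType.

(** Integrate the pointwise bound over [[lo, hi]] and exchange sum and integral, all terms being
    non-negative. *)
Lemma interval_cover (lo hi M : R) (w A B : nat -> R) : lo <= hi ->
  (forall k, 0 <= w k) -> (forall k, A k <= B k) ->
  (forall t : R, lo <= t <= hi ->
    (M%:E <= \sum_(0 <= k <oo) (w k * \1_`[A k, B k] t)%:E)%E) ->
  ((M * (hi - lo))%:E <= \sum_(0 <= k <oo) (w k * (B k - A k))%:E)%E.
Proof.
move=> lohi w0 AB cover.
have [M0|M0] := leP M 0.
  apply: (@le_trans _ _ 0%E); first by rewrite lee_fin mulr_le0_ge0 // subr_ge0.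
  by apply: nneseries_ge0 => k _ _; rewrite lee_fin mulr_ge0 // subr_ge0.
pose D : set R := `[lo, hi]%classic; pose mu := @lebesgue_measure R.
have mD : measurable D by exact: measurable_itv.
have muI (u v : R) : u <= v -> mu `[u, v]%classic = (v - u)%:E.
  move=> uv; rewrite /mu lebesgue_measure_itv /= lte_fin.
  by case: ltgtP uv => // -> _; rewrite subrr.
have mf k : measurable_fun D (fun t : R => (w k * \1_`[A k, B k] t)%:E).
  apply/measurable_EFinP; apply: measurable_funM => //.
have f0 k t : (0 <= (w k * \1_`[A k, B k] t)%:E)%E by rewrite lee_fin mulr_ge0.
have : (\int[mu]_(t in D) M%:E <= \int[mu]_(t in D)
    \sum_(0 <= k <oo) (w k * \1_`[A k, B k] t)%:E)%E.
  apply: ge0_le_integral => //.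
  - by move=> t _; rewrite lee_fin ltW.
  - apply: (@ge0_emeasurable_sum _ _ _ D (fun k t => (w k * \1_`[A k, B k] t)%:E) xpredT).
    + by move=> k t _ _; exact: f0.
    + by move=> k _; exact: mf.
have muD : mu D = (hi - lo)%:E by exact: muI.
rewrite integral_cst // integral_nneseries //.
rewrite [X in (_ * X)%E]muD -EFinM => /le_trans; apply.
apply: lee_nneseries => [k _ _|k _]; first by apply: integral_ge0 => t _; exact: f0.
under eq_integral do rewrite EFinM.
rewrite ge0_integralZl_EFin //; last by apply/measurable_EFinP.
rewrite EFinM lee_wpmul2l ?lee_fin // integral_indic // -(muI _ _ (AB k)).
by apply: le_measure; rewrite ?inE //; exact: measurableI.
Qed.

(* The weights [w] make the induction on the dimension go through: integrating over one
   coordinate moves the length of an edge into the weight. *)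
Lemma box_cover n (lo hi : nat -> R) (M : R) (w : nat -> R) (A B : nat -> nat -> R) :
  (forall i, lo i <= hi i) -> (forall k, 0 <= w k) -> (forall k i, A k i <= B k i) ->
  (forall x : nat -> R, (forall i, (i < n)%N -> lo i <= x i <= hi i) ->
    (M%:E <= \sum_(0 <= k <oo) (w k * \prod_(i < n) \1_`[A k i, B k i] (x i))%:E)%E) ->
  ((M * \prod_(i < n) (hi i - lo i))%:E <=
    \sum_(0 <= k <oo) (w k * \prod_(i < n) (B k i - A k i))%:E)%E.
Proof.
move=> lohi + AB; elim: n M w => [|n IHn] M w w0 cover.
  have := cover lo; rewrite big_ord0 mulr1 => /(_ (fun i => ltac:(by []))).
  by move=> h; apply: (le_trans h); rewrite le_eqVlt; apply/orP; left; apply/eqP;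
    apply: eq_eseriesr => k _; rewrite !big_ord0.
rewrite big_ord_recr /= mulrA mulrAC.
rewrite (eq_eseriesr (g := fun k => (w k * (B k n - A k n) * \prod_(i < n) (B k i - A k i))%:E)).
  apply: IHn => [k|x xin]; first by rewrite mulr_ge0 // subr_ge0.
  rewrite (eq_eseriesr (g := fun k =>
    (w k * \prod_(i < n) \1_`[A k i, B k i] (x i) * (B k n - A k n))%:E)); last first.
    by move=> k _; rewrite mulrAC.
  apply: interval_cover => // [k|t tin].
    by rewrite mulr_ge0 // prodr_ge0.
  pose x' i := if i == n then t else x i.
  have := cover x'; rewrite (eq_eseriesr (g := fun k =>
    (w k * \prod_(i < n) \1_`[A k i, B k i] (x i) * \1_`[A k n, B k n] t)%:E)).
    apply=> i; rewrite /x'; case: eqVneq => [-> //|ni] iS; apply: xin; lia.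
  move=> k _; rewrite big_ord_recr /= mulrA /x' eqxx; congr (_ * _ * _)%:E.
  by apply: eq_bigr => i _; rewrite ltn_eqF.
by move=> k _; rewrite big_ord_recr /= mulrA mulrAC.
Qed.

(** A cover of total volume at most half that of the box contradicts [box_cover] with [M] and all
    weights equal to 1. *)
Lemma box_not_null n (lo hi : 'rV[R]_n) (E : set 'rV[R]_n) :
  (forall i, lo 0 i < hi 0 i) -> box lo hi `<=` E -> ~ lebesgue_null E.
Proof.
move=> lohi boxE null.
pose ext (v : 'rV[R]_n) (i : nat) : R := if insub i is Some j then v 0 j else 0.
have extE (v : 'rV[R]_n) (i : 'I_n) : ext v i = v 0 i by rewrite /ext valK.
have vol0 : 0 < box_volume lo hi by apply: prodr_gt0 => i _; rewrite subr_gt0.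
have [A [B [AB cover vol]]] := null (box_volume lo hi / 2) ltac:(by rewrite divr_gt0).
have := @box_cover n (ext lo) (ext hi) 1 (fun=> 1) (fun k => ext (A k)) (fun k => ext (B k)).
have le_ext (u v : 'rV[R]_n) : (forall i, u 0 i <= v 0 i) -> forall i, ext u i <= ext v i.
  by move=> uv i; rewrite /ext; case: insub.
move=> /(_ (le_ext _ _ (fun i => ltW (lohi i))) (fun=> ler01) (fun k => le_ext _ _ (AB k))).
rewrite mul1r (eq_bigr (fun i => hi 0 i - lo 0 i)); last by move=> i _; rewrite !extE.
rewrite (eq_eseriesr (g := fun k => (box_volume (A k) (B k))%:E)); last first.
  by move=> k _; rewrite mul1r; congr EFin; apply: eq_bigr => i _; rewrite !extE.
rewrite -/(box_volume lo hi) => covered.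
have : ((box_volume lo hi)%:E <= (box_volume lo hi / 2)%:E)%E.
  apply: le_trans vol; apply: covered => x xin.
  have [k _ kin] := cover _ (boxE (\row_i x i) (fun i => ltac:(rewrite mxE -!extE; exact: xin))).
  have pk : 1 * \prod_(i < n) \1_`[ext (A k) i, ext (B k) i] (x i) = 1 :> R.
    rewrite mul1r big1 // => i _; rewrite indicE mem_set //= in_itv /= !extE.
    by have := kin i; rewrite mxE.
  rewrite (@nneseriesD1 _ _ k) //; last by move=> j _; rewrite lee_fin mul1r prodr_ge0.
  rewrite pk leeDl //; apply: nneseries_ge0 => j _ _.
  by rewrite lee_fin mul1r prodr_ge0.
rewrite lee_fin ler_pdivlMr // mulr_natr mulr2n gerDl leNgt vol0.
by [].
Qed.
End Boxes.

(** * Conclusion *)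

Section Final.
Variable R : realType.

Lemma partial_momentum_x (i j : 'I_8) (z : cotangent R 8) :
  partial (lshift 8 j) (momentum i) z = 0.
Proof.
by apply: derive_of_line (is_derive_cst _ _ _) => h; rewrite momentum_line_x.
Qed.

Lemma partial_momentum_p (i j : 'I_8) (z : cotangent R 8) :
  partial (rshift 8 j) (momentum i) z = (i == j)%:R.
Proof.
apply: derive_of_line (is_derive_cubic (momentum i z) _ 0 0) => h.
by rewrite momentum_line_p mulrC addrC !mul0r !addr0.
Qed.

(** The rows of p_3, ..., p_8 are unit vectors, so their multipliers correct the relation between
    the outer rows in those six columns and disturb no other. *)
Lemma row_free_dependent (f g : 'I_(8 + 8) -> R) (m : 'I_8 -> 'I_(8 + 8) -> R)
    (M : 'M[R]_(8, 8 + 8)) (lm : R * R) :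
  (forall i j, m i (lshift 8 j) = 0) -> (forall i j, m i (rshift 8 j) = (i == j)%:R) ->
  (forall k e, M k e = nth 0 [:: f e; m (ord8 3) e; m (ord8 4) e; m (ord8 5) e;
    m (ord8 6) e; m (ord8 7) e; m (ord8 8) e; g e] k) ->
  lm != 0 ->
  (forall e : 'I_(8 + 8), (forall i : 'I_8, i != ord8 1 -> i != ord8 2 -> e != rshift 8 i) ->
    lm.1 * f e + lm.2 * g e = 0) ->
  ~ row_free M.
Proof.
move=> mx mp ME lm0 rel freeM.
pose c (i : 'I_8) := - (lm.1 * f (rshift 8 i) + lm.2 * g (rshift 8 i)).
pose v : 'rV[R]_8 := \row_k nth 0 [:: lm.1; c (ord8 3); c (ord8 4); c (ord8 5);
  c (ord8 6); c (ord8 7); c (ord8 8); lm.2] k.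
have vM e : (v *m M) 0 e = lm.1 * f e + (
    c (ord8 3) * m (ord8 3) e + c (ord8 4) * m (ord8 4) e + c (ord8 5) * m (ord8 5) e
    + c (ord8 6) * m (ord8 6) e + c (ord8 7) * m (ord8 7) e
    + c (ord8 8) * m (ord8 8) e) + lm.2 * g e.
  by rewrite mxE !big_ord_recr big_ord0 /= !mxE !ME /= add0r !addrA.
have vM0 : v *m M = 0 *m M.
  rewrite mul0mx; apply/rowP => e; rewrite vM mxE.
  case: (split_ordP e) => j ->.
    rewrite !mx !mulr0 !addr0; apply: rel => i _ _.
    by rewrite eq_lrshift.
  rewrite !mp.
  have [j1|j1] := eqVneq j (ord8 1).
    rewrite j1 /= !mulr0 !addr0; apply: rel => i i1 _.
    by rewrite eq_rshift eq_sym.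
  have [j2|j2] := eqVneq j (ord8 2).
    rewrite j2 /= !mulr0 !addr0; apply: rel => i _ i2.
    by rewrite eq_rshift eq_sym.
  have -> : c (ord8 3) * (ord8 3 == j)%:R + c (ord8 4) * (ord8 4 == j)%:R
    + c (ord8 5) * (ord8 5 == j)%:R + c (ord8 6) * (ord8 6 == j)%:R
    + c (ord8 7) * (ord8 7 == j)%:R + c (ord8 8) * (ord8 8 == j)%:R = c j.
    case: j j1 j2 => [[|[|[|[|[|[|[|[|j]]]]]]]] jP] //= _ _;
      by rewrite !(mulr0, mulr1, addr0, add0r); congr c; apply: val_inj.
  by rewrite /c; ring.
have v0 := row_free_inj freeM vM0.
have l0 : lm.1 = 0.
  by have := congr1 (fun u : 'rV[R]_8 => u 0 (ord8 1)) v0; rewrite !mxE.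
have m0 : lm.2 = 0.
  by have := congr1 (fun u : 'rV[R]_8 => u 0 (ord8 8)) v0; rewrite !mxE.
by move: lm0; rewrite (surjective_pairing lm) l0 m0 eqxx.
Qed.

Lemma not_independent_at (F : cotangent R 8 -> R) (z : cotangent R 8) (lm : R * R) :
  lm != 0 ->
  (forall e : 'I_(8 + 8), (forall i : 'I_8, i != ord8 1 -> i != ord8 2 -> e != rshift 8 i) ->
    lm.1 * partial e (@H2358 R) z + lm.2 * partial e F z = 0) ->
  ~ independent_at [:: @H2358 R; 'p_3; 'p_4; 'p_5; 'p_6; 'p_7; 'p_8; F] z.
Proof.
move=> lm0 rel; apply: (@row_free_dependent (fun e => partial e (@H2358 R) z)
  (fun e => partial e F z) (fun i e => partial e (momentum i) z) _ lm) => //.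
- by move=> i j; exact: partial_momentum_x.
- by move=> i j; exact: partial_momentum_p.
by case=> [[|[|[|[|[|[|[|[|k]]]]]]]] kP] e //; rewrite !mxE.
Qed.

End Final.

Theorem theorem3 (R : realType) (d : nat) (d_bounds : (1 <= d <= 5)%N) :
  ~ exists F : 'rV[R]_(8 + 8) -> R, final_integral d F.
Proof.
move=> [F [[a [a_smooth Fa]] F_integral]].
have {Fa} FE : F = momentum_form a by apply/funext.
rewrite FE in F_integral * => independent; clear F FE.
(* On this box p_7 >= 2 and p_6 p_8 <= 3, so p_7 is non-zero and p_7^2 exceeds p_6 p_8. *)
pose lo : cotangent R 8 := row_mx 0 (\row_(i < 8) nth 0 [:: 0; 0; 0; 0; 0; 2; 2; 0] i).
pose hi : cotangent R 8 := row_mx (const_mx 1) (\row_(i < 8) nth 0 [:: 1; 1; 1; 1; 1; 3; 3; 1] i).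
apply: (@box_not_null R _ lo hi) independent.
  move=> e; case: (split_ordP e) => i ->; rewrite /lo /hi ?row_mxEl ?row_mxEr !mxE ?ltr01 //.
  by case: i => [[|[|[|[|[|[|[|[|i]]]]]]]] iP] //=; rewrite ?ltr01 // ltr_nat.
move=> z zin /=.
have p_in (i : 'I_8) : nth 0 [:: 0; 0; 0; 0; 0; 2; 2; 0] i <= momentum i z
    <= nth 0 [:: 1; 1; 1; 1; 1; 3; 3; 1] i.
  by have := zin (rshift 8 i); rewrite /lo /hi !row_mxEr !mxE.
have /= /andP[p6l p6u] := p_in (ord8 6); have /= /andP[p7l p7u] := p_in (ord8 7).
have /= /andP[p8l p8u] := p_in (ord8 8).
have p7_neq0 : 'p_7 z != 0 by rewrite gt_eqF //; lra.
have p_disc : 'p_7 z ^+ 2 != 'p_6 z * 'p_8 z by rewrite gt_eqF //; nra.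
have [lm lm0 rel] := partials_dependent a_smooth F_integral p7_neq0 p_disc.
exact: not_independent_at rel.
Qed.
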